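(* Let $\mathbb{K}$ be a field of characteristic zero, $G$ an abelian group with identity $e$, $\varepsilon$ an anti-symmetric bicharacter of $G$ with values in $\mathbb{K}^\times$, and let $\mathfrak{g}$ be a $G$-graded $\varepsilon$-Lie algebra (color Lie algebra) over $\mathbb{K}$ with universal enveloping algebra $\mathcal{U}(\mathfrak{g})$. If the second graded cohomology group $\mathbf{H}^2(\mathfrak{g},\mathbb{K})_e$ of $\mathfrak{g}$ with values in $\mathbb{K}$ is different from zero, then the associative algebra $\mathcal{U}(\mathfrak{g})$ admits a non-trivial graded deformation.
   Context: Let $G$ be an abelian group, written multiplicatively, with identity $e$. An anti-symmetric bicharacter is a map $\varepsilon:G\times G\to\mathbb{K}^\times$ with $\varepsilon(g,h)\varepsilon(h,g)=1$, $\varepsilon(g,hk)=\varepsilon(g,h)\varepsilon(g,k)$, $\varepsilon(gh,k)=\varepsilon(g,k)\varepsilon(h,k)$. A $G$-graded $\varepsilon$-Lie algebra (color Lie algebra) is a $G$-graded vector space $L=\bigoplus_{g\in G}L_g$ with a bilinear bracket such that $[L_g,L_h]\subseteq L_{gh}$ and, for homogeneous $a,b,c$ (with $|a|$ the degree of $a$), $[a,b]=-\varepsilon(|a|,|b|)[b,a]$ and $\varepsilon(|c|,|a|)[a,[b,c]]+\varepsilon(|a|,|b|)[b,[c,a]]+\varepsilon(|b|,|c|)[c,[a,b]]=0$. The universal enveloping algebra $\mathcal{U}(L)$ is the quotient of the tensor algebra $T(L)$ by the two-sided ideal generated by $a\otimes b-\varepsilon(|a|,|b|)\,b\otimes a-[a,b]$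 for homogeneous $a,b\in L$. It is a $G$-graded associative unital algebra. Cohomology: $\mathbb{K}$ is the trivial $\mathfrak{g}$-module, concentrated in degree $e$. A 2-cocycle of degree $e$ is a bilinear map $\omega:\mathfrak{g}\times\mathfrak{g}\to\mathbb{K}$ with $\omega(\mathfrak{g}_g,\mathfrak{g}_h)=0$ unless $gh=e$, with $\omega(x,y)=-\varepsilon(|x|,|y|)\omega(y,x)$, and with $$\omega([x,y],z)-\varepsilon(|y|,|z|)\,\omega([x,z],y)+\varepsilon(|x|,|y|)\varepsilon(|x|,|z|)\,\omega([y,z],x)=0$$ for all homogeneous $x,y,z\in\mathfrak{g}$. A 2-coboundary of degree $e$ is a map of the form $(x,y)\mapsto -f([x,y])$ with $f:\mathfrak{g}\to\mathbb{K}$ linear and $f(\mathfrak{g}_g)=0$ for $g\ne e$. $\mathbf{H}^2(\mathfrak{g},\mathbb{K})_e$ is the quotient of the space of 2-cocycles of degree $e$ by the space of 2-coboundaries of degree $e$. A linear or bilinear map between $G$-graded spaces has degree $e$ if the value on homogeneous arguments is homogeneous of degree the product of the degrees of the arguments. A graded deformation of a $G$-graded associative algebra $(A,m_0)$ is an associative $\mathbb{K}[[t]]$-bilinear multiplication $m_t=\sum_{n\ge0}m_n t^n$ on $A[[t]]$, where each $m_n:A\times A\to A$ is bilinear of degree $e$ and $m_0$ is the multiplication of $A$. Two graded deformations $m_t,m_t'$ are equivalent if there is $f=\mathrm{id}+\sum_{n\ge1}t^nf_n$, with each $f_n:A\to A$ linear of degree $e$ (extended $\mathbb{K}[[t]]$-linearly),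 such that $m_t'=f^{-1}\circ m_t\circ(f\times f)$. A graded deformation is trivial if it is equivalent to $m_0$ extended $\mathbb{K}[[t]]$-bilinearly. *)

(* Defs.v *)
From HB Require Import structures.
From mathcomp Require Import all_boot all_algebra.
From mathcomp Require Import generic_quotient ring_quotient.
From mathcomp Require Import boolp classical_sets functions.
From mathcomp Require Import finmap monalg.
From mathcomp Require Import ring.

Set Implicit Arguments.
Unset Strict Implicit.
Unset Printing Implicit Defensive.

Import GRing.Theory.
Local Open Scope ring_scope.
Local Open Scope quotient_scope.

Section ModuleQuotient.
Variables (K : pzRingType) (V : lmodType K) (W : submodClosed V).

(* [submodClosed] only records closure under sums and scaling, whereas
   [Quotient.quot] wants a [zmodClosed] predicate. *)
Definition submod_pred : {pred V} := fun x => x \in W.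

Lemma submod_pred_closed : zmod_closed submod_pred.
Proof. exact: GRing.submod_closedB (submodClosedP W). Qed.
HB.instance Definition _ := GRing.isZmodClosed.Build V submod_pred
  submod_pred_closed.

Definition modquot : Type := Quotient.quot submod_pred.
HB.instance Definition _ := GRing.Zmodule.on modquot.
End ModuleQuotient.

HB.lock Definition modquot_pi (K : pzRingType) (V : lmodType K)
    (W : submodClosed V) (x : V) : modquot W :=
  \pi_(Quotient.quot (submod_pred W)) x.

HB.lock Definition modquot_repr (K : pzRingType) (V : lmodType K)
    (W : submodClosed V) (q : modquot W) : V := repr q.

HB.lock Definition modquot_scale (K : pzRingType) (V : lmodType K)
    (W : submodClosed V) (a : K) (q : modquot W) : modquot W :=
  modquot_pi W (a *: modquot_repr q).

Section ModuleQuotientTheory.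
Variables (K : pzRingType) (V : lmodType K) (W : submodClosed V).
Local Notation modquot := (modquot W).
Local Notation modquot_pi := (modquot_pi W).
Local Notation modquot_scale := (@modquot_scale K V W).

Lemma modquot_reprK : cancel (@modquot_repr K V W) modquot_pi.
Proof. by move=> q; rewrite modquot_pi.unlock modquot_repr.unlock reprK. Qed.

Lemma modquot_pi_eq x y : modquot_pi x = modquot_pi y <-> x - y \in W.
Proof.
rewrite modquot_pi.unlock.
have -> : (x - y \in W) = (x == y %[mod Quotient.quot (submod_pred W)]).
  exact: (Quotient.idealrBE (submod_pred W)).
by split => /eqP.
Qed.

Lemma modquot_pi_surj q : exists x, q = modquot_pi x.
Proof. by exists (modquot_repr q); rewrite modquot_reprK. Qed.

Lemma modquot_pi_zmod : zmod_morphism modquot_pi.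
Proof. by move=> x y; rewrite modquot_pi.unlock raddfB. Qed.
HB.instance Definition _ :=
  GRing.isZmodMorphism.Build V modquot modquot_pi modquot_pi_zmod.

Lemma modquot_piZ a x : modquot_pi (a *: x) = modquot_scale a (modquot_pi x).
Proof.
rewrite modquot_scale.unlock; apply/esym/modquot_pi_eq.
by rewrite -scalerBr rpredZ //; apply/modquot_pi_eq; rewrite modquot_reprK.
Qed.

Lemma modquot_scaleA a b q :
  modquot_scale a (modquot_scale b q) = modquot_scale (a * b) q.
Proof. by have [x ->] := modquot_pi_surj q; rewrite -!modquot_piZ scalerA. Qed.

Lemma modquot_scale1 : left_id 1 modquot_scale.
Proof.
by move=> q; have [x ->] := modquot_pi_surj q; rewrite -modquot_piZ scale1r.
Qed.

Lemma modquot_scaleDr : right_distributive modquot_scale +%R.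
Proof.
move=> a p q; have [x ->] := modquot_pi_surj p.
have [y ->] := modquot_pi_surj q.
by rewrite -raddfD -!modquot_piZ scalerDr raddfD.
Qed.

Lemma modquot_scaleDl q : {morph modquot_scale^~ q : a b / a + b}.
Proof.
by move=> a b; have [x ->] := modquot_pi_surj q;
   rewrite -!modquot_piZ scalerDl raddfD.
Qed.

HB.instance Definition _ := GRing.Zmodule_isLmodule.Build K modquot
  modquot_scaleA modquot_scale1 modquot_scaleDr modquot_scaleDl.
HB.instance Definition _ :=
  GRing.isScalable.Build K V modquot *:%R modquot_pi modquot_piZ.

End ModuleQuotientTheory.

Section Span.
Variables (K : pzRingType) (V : lmodType K).

Definition lspan (S : set V) : {pred V} := fun x =>
  `[< forall W : submodClosed V, (forall y, S y -> y \in W) -> x \in W >].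

Lemma lspan_closed S : submod_closed (lspan S).
Proof.
split=> [|a x y /asboolP xS /asboolP yS]; apply/asboolP => W SW.
  exact: rpred0.
by rewrite rpredD ?rpredZ ?xS ?yS.
Qed.
HB.instance Definition _ S := GRing.isSubmodClosed.Build K V (lspan S)
  (GRing.submod_closed_semi (lspan_closed S)).

Lemma lspan_sub (S : set V) x : S x -> x \in lspan S.
Proof. by move=> Sx; apply/asboolP => W; apply. Qed.

Lemma lspan_min (S : set V) (W : submodClosed V) :
  (forall y, S y -> y \in W) -> {subset lspan S <= W}.
Proof. by move=> SW x /asboolP; apply. Qed.
End Span.

Section AlgebraQuotient.
Variables (K : comPzRingType) (A : algType K).

Inductive in_ideal (S : set A) : A -> Prop :=
| ideal0 : in_ideal S 0
| idealD x y : in_ideal S x -> in_ideal S y -> in_ideal S (x + y)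
| idealM x s y : S s -> in_ideal S (x * s * y).

Definition ideal_gen (S : set A) : {pred A} := fun x => `[< in_ideal S x >].

Lemma ideal_gen_closed S : submod_closed (ideal_gen S).
Proof.
split=> [|a x y /asboolP xS /asboolP yS]; apply/asboolP; first exact: ideal0.
apply: idealD => //; elim: xS => [|u v _ uS _ vS|u s v Ss].
- by rewrite scaler0; apply: ideal0.
- by rewrite scalerDr; apply: idealD.
- by rewrite 2!scalerAl; apply: idealM.
Qed.
HB.instance Definition _ S := GRing.isSubmodClosed.Build K A (ideal_gen S)
  (GRing.submod_closed_semi (ideal_gen_closed S)).

Lemma ideal_gen_mull S a x : x \in ideal_gen S -> a * x \in ideal_gen S.
Proof.
move=> /asboolP xS; apply/asboolP; elim: xS => [|u v _ uS _ vS|u s v Ss].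
- by rewrite mulr0; apply: ideal0.
- by rewrite mulrDr; apply: idealD.
- by rewrite 2!mulrA; apply: idealM.
Qed.

Lemma ideal_gen_mulr S a x : x \in ideal_gen S -> x * a \in ideal_gen S.
Proof.
move=> /asboolP xS; apply/asboolP; elim: xS => [|u v _ uS _ vS|u s v Ss].
- by rewrite mul0r; apply: ideal0.
- by rewrite mulrDl; apply: idealD.
- by rewrite -mulrA; apply: idealM.
Qed.

Lemma ideal_gen_sub (S : set A) s : S s -> s \in ideal_gen S.
Proof.
by move=> Ss; apply/asboolP; rewrite -[s]mulr1 -[s]mul1r; apply: idealM.
Qed.

(* An [algType] is nontrivial by definition, hence the properness argument. *)
Definition algquot_of (S : set A) (_ : 1 \notin ideal_gen S) : Type :=
  modquot (ideal_gen S).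

End AlgebraQuotient.

HB.lock Definition algquot_mul (K : comPzRingType) (A : algType K) (S : set A)
    (Sproper : 1 \notin ideal_gen S) (p q : algquot_of Sproper) :
    algquot_of Sproper :=
  modquot_pi (ideal_gen S) (modquot_repr p * modquot_repr q).

Section AlgebraQuotientTheory.
Variables (K : comPzRingType) (A : algType K).
Variables (S : set A) (Sproper : 1 \notin ideal_gen S).
Local Notation algquot := (algquot_of Sproper).
Local Notation algquot_mul := (@algquot_mul K A S Sproper).

HB.instance Definition _ := GRing.Lmodule.on algquot.

Definition algquot_pi : A -> algquot := @modquot_pi K A (ideal_gen S).
HB.instance Definition _ := GRing.Linear.on algquot_pi.

Lemma algquot_pi_eq x y :
  algquot_pi x = algquot_pi y <-> x - y \in ideal_gen S.
Proof. exact: modquot_pi_eq. Qed.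

Lemma algquot_pi_surj q : exists x, q = algquot_pi x.
Proof. exact: modquot_pi_surj. Qed.

Lemma algquot_reprK q : algquot_pi (modquot_repr q) = q.
Proof. exact: modquot_reprK. Qed.

Lemma algquot_piM x y :
  algquot_pi (x * y) = algquot_mul (algquot_pi x) (algquot_pi y).
Proof.
have rE z : z - modquot_repr (algquot_pi z) \in ideal_gen S.
  by apply/algquot_pi_eq; rewrite algquot_reprK.
rewrite algquot_mul.unlock; apply/algquot_pi_eq.
rewrite -(subrKA (modquot_repr (algquot_pi x) * y)) -mulrBl -mulrBr rpredD //.
  exact: ideal_gen_mulr.
exact: ideal_gen_mull.
Qed.

Lemma algquot_mulA : associative algquot_mul.
Proof.
move=> p q r; have [x ->] := algquot_pi_surj p.
have [y ->] := algquot_pi_surj q; have [z ->] := algquot_pi_surj r.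
by rewrite -!algquot_piM mulrA.
Qed.

Lemma algquot_mul1 : left_id (algquot_pi 1) algquot_mul.
Proof.
by move=> p; have [x ->] := algquot_pi_surj p; rewrite -algquot_piM mul1r.
Qed.

Lemma algquot_mulr1 : right_id (algquot_pi 1) algquot_mul.
Proof.
by move=> p; have [x ->] := algquot_pi_surj p; rewrite -algquot_piM mulr1.
Qed.

Lemma algquot_mulDl : left_distributive algquot_mul +%R.
Proof.
move=> p q r; have [x ->] := algquot_pi_surj p.
have [y ->] := algquot_pi_surj q; have [z ->] := algquot_pi_surj r.
by rewrite -raddfD -!algquot_piM mulrDl raddfD.
Qed.

Lemma algquot_mulDr : right_distributive algquot_mul +%R.
Proof.
move=> p q r; have [x ->] := algquot_pi_surj p.
have [y ->] := algquot_pi_surj q; have [z ->] := algquot_pi_surj r.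
by rewrite -raddfD -!algquot_piM mulrDr raddfD.
Qed.

Lemma algquot_1neq0 : algquot_pi 1 != 0.
Proof.
apply/negP => /eqP; rewrite -(raddf0 algquot_pi) => /algquot_pi_eq.
by rewrite subr0; apply/negP.
Qed.

HB.instance Definition _ := GRing.Zmodule_isNzRing.Build algquot
  algquot_mulA algquot_mul1 algquot_mulr1 algquot_mulDl algquot_mulDr
  algquot_1neq0.

Lemma algquot_pi_monoid : monoid_morphism algquot_pi.
Proof. by split=> // x y; rewrite algquot_piM. Qed.
HB.instance Definition _ :=
  GRing.isMonoidMorphism.Build A algquot algquot_pi algquot_pi_monoid.

Lemma algquot_scaleAl a (p q : algquot) : a *: (p * q) = (a *: p) * q.
Proof.
have [x ->] := algquot_pi_surj p; have [y ->] := algquot_pi_surj q.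
by rewrite -rmorphM -!linearZ -rmorphM /= scalerAl.
Qed.
HB.instance Definition _ :=
  GRing.Lmodule_isLalgebra.Build K algquot algquot_scaleAl.

Lemma algquot_scaleAr a (p q : algquot) : a *: (p * q) = p * (a *: q).
Proof.
have [x ->] := algquot_pi_surj p; have [y ->] := algquot_pi_surj q.
by rewrite -rmorphM -!linearZ -rmorphM /= scalerAr.
Qed.
HB.instance Definition _ :=
  GRing.Lalgebra_isAlgebra.Build K algquot algquot_scaleAr.


Section Lift.
Variables (B : algType K) (F : {lrmorphism A -> B}).
Hypothesis FS : forall s, S s -> F s = 0.

Lemma ideal_gen_ker x : x \in ideal_gen S -> F x = 0.
Proof.
move=> /asboolP; elim=> [|u v _ Fu _ Fv|u s v Ss]; first exact: raddf0.
  by rewrite raddfD /= Fu Fv addr0.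
by rewrite !rmorphM /= (FS Ss) mulr0 mul0r.
Qed.

Lemma algquot_lift :
  exists G : {lrmorphism algquot -> B}, forall x, G (algquot_pi x) = F x.
Proof.
pose G (q : algquot) : B := F (modquot_repr q).
have Gpi x : G (algquot_pi x) = F x.
  apply/eqP; rewrite -subr_eq0 -raddfB /=; apply/eqP/ideal_gen_ker.
  by apply/algquot_pi_eq; rewrite algquot_reprK.
have G1 : zmod_morphism G.
  move=> p q; have [x ->] := algquot_pi_surj p.
  by have [y ->] := algquot_pi_surj q; rewrite -raddfB !Gpi raddfB.
have G2 : monoid_morphism G.
  split=> [|p q]; first by rewrite -(rmorph1 algquot_pi) Gpi rmorph1.
  have [x ->] := algquot_pi_surj p; have [y ->] := algquot_pi_surj q.
  by rewrite -rmorphM !Gpi rmorphM.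
have G3 : scalable G.
  move=> a p; have [x ->] := algquot_pi_surj p.
  by rewrite -linearZ !Gpi linearZ.
pose H1 := GRing.isZmodMorphism.Build _ _ G G1.
pose H2 := GRing.isMonoidMorphism.Build _ _ G G2.
pose H3 := GRing.isScalable.Build K _ _ *:%R G G3.
pose GL : {lrmorphism algquot -> B} := HB.pack G H1 H2 H3.
by exists GL.
Qed.
End Lift.
End AlgebraQuotientTheory.

Section FreeAlgebra.
Variables (K : fieldType) (X : choiceType).

Lemma malgZU a c (m : {fmonom X}) :
  a *: << c *g m >> = << a * c *g m >> :> {malg K[{fmonom X}]}.
Proof. by apply/malgP => k; rewrite mcoeffZ 2!mcoeffU mulrnAr. Qed.

Definition freealg : Type := {malg K[{fmonom X}]}.
HB.instance Definition _ := GRing.Lalgebra.on freealg.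

Lemma freealg_scaleAr a (p q : freealg) : a *: (p * q) = p * (a *: q).
Proof.
rewrite malgME (malgMEw (fsubset_refl _) (msuppZ_le a q)) scaler_sumr.
apply: eq_bigr => k _; rewrite scaler_sumr; apply: eq_bigr => l _.
by rewrite mcoeffZ malgZU mulrCA.
Qed.
HB.instance Definition _ :=
  GRing.Lalgebra_isAlgebra.Build K freealg freealg_scaleAr.

Definition letter (x : X) : freealg := << fmu x >>.

Section Lift.
Variables (B : algType K) (f : X -> B).

Definition word_eval (m : {fmonom X}) : B := \prod_(x <- (m : seq X)) f x.

Lemma word_eval_mmorphism : mmorphism word_eval.
Proof.
split=> [m n|]; rewrite /word_eval; first by rewrite fmM big_cat.
by rewrite fm1 big_nil.
Qed.
HB.instance Definition _ :=
  isMultiplicative.Build {fmonom X} B word_eval word_eval_mmorphism.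

Definition freealg_eval : freealg -> B := mmap (in_alg B) word_eval.

Lemma freealg_evalD : zmod_morphism freealg_eval.
Proof. exact: raddfB. Qed.
Lemma freealg_evalM : monoid_morphism freealg_eval.
Proof.
have [] := @commr_mmap_is_multiplicative _ _ _ (in_alg B) word_eval.
  by move=> g m m'; rewrite /GRing.comm /= -scalerAl -scalerAr mul1r mulr1.
by [].
Qed.
Lemma freealg_evalZ : scalable freealg_eval.
Proof. by move=> a p; rewrite /freealg_eval mmapZ /= -scalerAl mul1r. Qed.
HB.instance Definition _ :=
  GRing.isZmodMorphism.Build freealg B freealg_eval freealg_evalD.
HB.instance Definition _ :=
  GRing.isMonoidMorphism.Build freealg B freealg_eval freealg_evalM.
HB.instance Definition _ :=
  GRing.isScalable.Build K freealg B *:%R freealg_eval freealg_evalZ.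

Lemma freealg_eval_letter x : freealg_eval (letter x) = f x.
Proof.
by rewrite /freealg_eval mmapU /= scale1r mul1r /word_eval fmU big_seq1.
Qed.
End Lift.

Lemma freealg_span (p : freealg) :
  p = \sum_(m <- msupp p) p@_m *: \prod_(x <- (m : seq X)) letter x.
Proof.
have wordE (m : {fmonom X}) : \prod_(x <- (m : seq X)) letter x = << m >>.
  case: m; elim=> [|x s IHs] /=; first by rewrite big_nil -fmoneE.
  have -> : FMonom (x :: s) = fmmul (fmu x) (FMonom s) by rewrite fmmulE fmuE.
  by rewrite big_cons IHs /letter malgM_def fgmulUU mulr1.
rewrite [LHS]monalgE; apply: eq_bigr => m _; rewrite wordE.
by rewrite malgZU mulr1.
Qed.

Lemma freealg_ext (B : algType K) (F G : {lrmorphism freealg -> B}) :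
  (forall x, F (letter x) = G (letter x)) -> F =1 G.
Proof.
move=> FG p; rewrite (freealg_span p) !raddf_sum; apply: eq_bigr => m _ /=.
rewrite !linearZ /= !rmorph_prod; congr (_ *: _).
by apply: eq_bigr => x _; apply: FG.
Qed.
End FreeAlgebra.


Section TensorAlgebra.
Variables (K : fieldType) (V : lmodType K).

(* T(V) is presented as the free algebra on the set V modulo linearity of
   V -> T(V); its words of length n then span the n-th tensor power. *)
Definition tensor_rel : set (freealg K V) :=
  [set r | exists (a : K) (x y : V),
     r = letter K (a *: x + y) - (a *: letter K x + letter K y)].

Lemma tensor_rel_eval (B : algType K) (f : {linear V -> B}) r :
  tensor_rel r -> freealg_eval f r = 0.
Proof.
case=> a [x [y ->]]; rewrite raddfB /= raddfD /= linearZ /=.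
by rewrite !freealg_eval_letter linearP subrr.
Qed.

Lemma tensor_proper : 1 \notin ideal_gen tensor_rel.
Proof.
apply/negP; pose z : {linear V -> K^o} := \0.
move/(ideal_gen_ker (@tensor_rel_eval _ z))/eqP.
by rewrite rmorph1 oner_eq0.
Qed.

Definition tensor_alg : Type := algquot_of tensor_proper.
HB.instance Definition _ := GRing.Algebra.on tensor_alg.

Definition tensor_in (x : V) : tensor_alg :=
  algquot_pi tensor_proper (letter K x).

Lemma tensor_in_linear : linear tensor_in.
Proof.
move=> a x y; rewrite /tensor_in -linearP; apply/algquot_pi_eq.
by apply: ideal_gen_sub; exists a, x, y.
Qed.
HB.instance Definition _ :=
  GRing.isLinear.Build K V tensor_alg *:%R tensor_in tensor_in_linear.

Lemma tensor_alg_lift (B : algType K) (f : {linear V -> B}) :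
  exists F : {lrmorphism tensor_alg -> B}, forall x, F (tensor_in x) = f x.
Proof.
have [F FE] := algquot_lift tensor_proper (@tensor_rel_eval _ f).
by exists F => x; rewrite FE /= freealg_eval_letter.
Qed.

Lemma tensor_alg_ext (B : algType K) (F F' : {lrmorphism tensor_alg -> B}) :
  (forall x, F (tensor_in x) = F' (tensor_in x)) -> F =1 F'.
Proof.
move=> FF' t; have [p ->] := @algquot_pi_surj _ _ _ tensor_proper t.
pose Fp : {lrmorphism freealg K V -> B} := F \o algquot_pi tensor_proper.
pose F'p : {lrmorphism freealg K V -> B} := F' \o algquot_pi tensor_proper.
exact: (@freealg_ext K V B Fp F'p).
Qed.
End TensorAlgebra.

Definition is_grading (K : pzRingType) (G : groupType) (V : lmodType K)
    (comp : G -> submodClosed V) : Prop :=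
  (forall x, exists (s : seq G) (f : G -> V),
     [/\ uniq s, forall g, f g \in comp g & x = \sum_(g <- s) f g]) /\
  (forall (s : seq G) (f : G -> V),
     uniq s -> (forall g, f g \in comp g) -> \sum_(g <- s) f g = 0 ->
     forall g, g \in s -> f g = 0).

Record antisym_bicharacter (K : fieldType) (G : groupType)
    (eps : G -> G -> K) : Prop := AntisymBicharacter {
  bichar_neq0 : forall g h, eps g h != 0;
  bichar_antisym : forall g h, eps g h * eps h g = 1;
  bicharMr : forall g h k, eps g (h * k)%g = eps g h * eps g k;
  bicharMl : forall g h k, eps (g * h)%g k = eps g k * eps h k
}.

Record colorLieAlgebra (K : fieldType) (G : groupType) (eps : G -> G -> K) :=
    ColorLieAlgebra {
  color_car :> lmodType K;
  color_comp : G -> submodClosed color_car;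
  color_br : color_car -> color_car -> color_car;
  color_grading : is_grading color_comp;
  color_br_linearl : forall y, linear (color_br^~ y);
  color_br_linearr : forall x, linear (color_br x);
  color_br_comp : forall g h x y, x \in color_comp g -> y \in color_comp h ->
    color_br x y \in color_comp (g * h)%g;
  color_br_antisym : forall g h x y,
    x \in color_comp g -> y \in color_comp h ->
    color_br x y = - (eps g h *: color_br y x);
  color_br_jacobi : forall g h k x y z,
    x \in color_comp g -> y \in color_comp h -> z \in color_comp k ->
    eps k g *: color_br x (color_br y z) +
    eps g h *: color_br y (color_br z x) +
    eps h k *: color_br z (color_br x y) = 0
}.

Section EnvelopingAlgebra.
Variables (K : fieldType) (G : groupType) (eps : G -> G -> K).
Variable L : colorLieAlgebra eps.
Local Notation comp := (@color_comp K G eps L).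
Local Notation br := (@color_br K G eps L).
Local Notation T := (tensor_alg L).

Definition env_rel : set T :=
  [set r | exists (g h : G) (x y : L),
     [/\ x \in comp g, y \in comp h &
       r = tensor_in x * tensor_in y
           - eps g h *: (tensor_in y * tensor_in x) - tensor_in (br x y)]].

Lemma env_proper : 1 \notin ideal_gen env_rel.
Proof.
apply/negP; pose z : {linear L -> K^o} := \0.
have [F FE] := tensor_alg_lift z.
have Frel r : env_rel r -> F r = 0.
  case=> g [h [x [y [_ _ ->]]]].
  rewrite raddfB /= raddfB /= linearZ /= rmorphM rmorphM /=.
  by rewrite !FE mul0r scaler0 !subr0.
by move/(ideal_gen_ker Frel)/eqP; rewrite rmorph1 oner_eq0.
Qed.

Definition env_alg : Type := algquot_of env_proper.
HB.instance Definition _ := GRing.Algebra.on env_alg.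

Definition env_pi : T -> env_alg := algquot_pi env_proper.
HB.instance Definition _ := GRing.LRMorphism.on env_pi.

Definition env_in (x : L) : env_alg := env_pi (tensor_in x).
HB.instance Definition _ := GRing.Linear.copy env_in (env_pi \o @tensor_in K L).

Lemma env_in_br g h x y : x \in comp g -> y \in comp h ->
  env_in x * env_in y - eps g h *: (env_in y * env_in x) = env_in (br x y).
Proof.
move=> xg yh; pose p := tensor_in x * tensor_in y.
have : env_pi (p - eps g h *: (tensor_in y * tensor_in x)) = env_in (br x y).
  by apply/algquot_pi_eq/ideal_gen_sub; exists g, h, x, y.
by rewrite raddfB /= linearZ /= /p !rmorphM.
Qed.

Lemma env_alg_lift (B : algType K) (f : {linear L -> B}) :
  (forall g h x y, x \in comp g -> y \in comp h ->
     f x * f y - eps g h *: (f y * f x) = f (br x y)) ->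
  exists F : {lrmorphism env_alg -> B}, forall x, F (env_in x) = f x.
Proof.
move=> fbr; have [F FE] := tensor_alg_lift f.
have Frel r : env_rel r -> F r = 0.
  case=> g [h [x [y [xg yh ->]]]].
  rewrite raddfB /= raddfB /= linearZ /= rmorphM rmorphM /=.
  by rewrite !FE (fbr g h) // subrr.
have [H HE] := algquot_lift env_proper Frel.
by exists H => x; rewrite HE FE.
Qed.

Lemma env_alg_ext (B : algType K) (F F' : {lrmorphism env_alg -> B}) :
  (forall x, F (env_in x) = F' (env_in x)) -> F =1 F'.
Proof.
move=> FF' u; have [t ->] := @algquot_pi_surj _ _ _ env_proper u.
pose Fp : {lrmorphism T -> B} := F \o env_pi.
pose F'p : {lrmorphism T -> B} := F' \o env_pi.
exact: (@tensor_alg_ext K L B Fp F'p).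
Qed.

Definition tensor_comp (g : G) : submodClosed T :=
  lspan [set t | exists s : seq (G * L),
    [/\ forall p, p \in s -> p.2 \in comp p.1,
        (\prod_(p <- s) p.1)%g = g &
        t = \prod_(p <- s) tensor_in p.2]].

(* The grading of U(L) is the image of that of T(L). *)
Definition env_comp_pred (g : G) : {pred env_alg} := fun u =>
  `[< exists2 t, t \in tensor_comp g & u = env_pi t >].

Lemma env_comp_closed g : submod_closed (env_comp_pred g).
Proof.
split=> [|a _ _ /asboolP[t tg ->] /asboolP[t' tg' ->]]; apply/asboolP.
  by exists 0; rewrite ?rpred0 ?raddf0.
by exists (a *: t + t'); rewrite ?rpredD ?rpredZ // linearP.
Qed.
HB.instance Definition _ g := GRing.isSubmodClosed.Build K env_alg
  (env_comp_pred g) (GRing.submod_closed_semi (env_comp_closed g)).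

Definition env_comp (g : G) : submodClosed env_alg := env_comp_pred g.

End EnvelopingAlgebra.

Section Cohomology.
Variables (K : fieldType) (G : groupType) (eps : G -> G -> K).
Variable L : colorLieAlgebra eps.
Local Notation comp := (@color_comp K G eps L).
Local Notation br := (@color_br K G eps L).

Record is_cocycle2 (w : L -> L -> K) : Prop := IsCocycle2 {
  cocycle2_linearl : forall y, scalar (w^~ y);
  cocycle2_linearr : forall x, scalar (w x);
  cocycle2_comp : forall g h x y, x \in comp g -> y \in comp h ->
    (g * h)%g <> 1%g -> w x y = 0;
  cocycle2_antisym : forall g h x y, x \in comp g -> y \in comp h ->
    w x y = - (eps g h * w y x);
  cocycle2_jacobi : forall g h k x y z,
    x \in comp g -> y \in comp h -> z \in comp k ->
    w (br x y) z - eps h k * w (br x z) y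
      + eps g h * eps g k * w (br y z) x = 0
}.

Definition is_coboundary2 (w : L -> L -> K) : Prop :=
  exists f : L -> K,
    [/\ scalar f, forall g x, x \in comp g -> g <> 1%g -> f x = 0 &
        w = fun x y => - f (br x y)].

Lemma coboundary2_cocycle w :
  antisym_bicharacter eps -> is_coboundary2 w -> is_cocycle2 w.
Proof.
move=> Heps [f [fl fe ->]].
have f0 : f 0 = 0.
  by have := fl (-1) 0 0; rewrite scaleN1r mulN1r oppr0 addr0 addNr.
have fZ a u : f (a *: u) = a * f u by rewrite -[a *: u]addr0 fl f0 addr0.
have fD u v : f (u + v) = f u + f v by rewrite -[u]scale1r fl scale1r mul1r.
have fN u : f (- u) = - f u by rewrite -scaleN1r fZ mulN1r.
have brE g h x y : x \in comp g -> y \in comp h ->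
    f (br x y) = - (eps g h * f (br y x)).
  by move=> xg yh; rewrite (color_br_antisym xg yh) fN fZ.
split=> [y a x x'|x a y y'|g h x y xg yh gh|g h x y xg yh|].
- by rewrite (color_br_linearl y) fl opprD mulrN.
- by rewrite (color_br_linearr x) fl opprD mulrN.
- by rewrite (fe _ _ (color_br_comp xg yh) gh) oppr0.
- by rewrite (brE g h) // mulrN.
move=> g h k x y z xg yh zk.
have J := congr1 f (color_br_jacobi xg yh zk).
rewrite f0 !fD !fZ in J.
have br_inner : f (br y (br x z)) = - (eps g k * f (br y (br z x))).
  have br0 : br y 0 = 0.
    by have := color_br_linearr y (-1) 0 0; rewrite !scaleN1r oppr0 addr0 addNr.
  have brZ a u : br y (a *: u) = a *: br y u.
    by rewrite -[a *: u]addr0 color_br_linearr br0 addr0.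
  by rewrite (color_br_antisym xg zk) -scaleNr brZ fZ mulNr.
rewrite (brE _ _ _ _ (color_br_comp xg yh) zk).
rewrite (brE _ _ _ _ (color_br_comp xg zk) yh) br_inner.
rewrite (brE _ _ _ _ (color_br_comp yh zk) xg) !(bicharMl Heps).
have := bichar_antisym Heps h k; have := bichar_antisym Heps g h.
have := bichar_antisym Heps g k; move: J.
move: (f (br x _)) (f (br y _)) (f (br z _)) => a b c J gk gh hk.
transitivity (eps g k * (eps k g * a + eps g h * b + eps h k * c)
  + (eps h k * eps k h - 1) * (eps g h * eps g k * b)
  + (eps g h * eps h g - 1) * (eps g k * eps k g) * a); first by ring.
by rewrite J hk gh subrr !mul0r mulr0 !addr0.
Qed.

(* K^o is K as a module over itself, giving the pointwise structure. *)
Definition Z2_pred : {pred L -> L -> K^o} := fun w => `[< is_cocycle2 w >].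

Lemma Z2_closed : submod_closed Z2_pred.
Proof.
split=> [|a w w' /asboolP[wl wr wc wa wj] /asboolP[wl' wr' wc' wa' wj']];
    apply/asboolP.
  suff : is_cocycle2 (fun _ _ : L => 0 : K) by [].
  by split=> [y a x x'|x a y y'|//|*|*] /=; rewrite ?mulr0 ?oppr0 ?addr0.
split=> [y b x x'|x b y y'|g h x y xg yh gh|g h x y xg yh|
         g h k x y z xg yh zk]; rewrite !addrfctE !scalrfctE.
- by rewrite wl wl' /GRing.scale /=; ring.
- by rewrite wr wr' /GRing.scale /=; ring.
- by rewrite (wc g h) ?(wc' g h) ?scaler0 ?addr0.
- by rewrite (wa g h x y) ?(wa' g h x y) // /GRing.scale /=; ring.
transitivity (a * 0 + 0 : K); last by rewrite mulr0 addr0.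
rewrite -[in a * 0](wj g h k x y z) // -[X in _ = _ + X](wj' g h k x y z) //.
by rewrite /GRing.scale /=; ring.
Qed.
HB.instance Definition _ := GRing.isSubmodClosed.Build K (L -> L -> K^o)
  Z2_pred (GRing.submod_closed_semi Z2_closed).

Record Z2 : Type := MkZ2 { Z2_val :> L -> L -> K^o; _ : Z2_val \in Z2_pred }.
HB.instance Definition _ := [isSub for Z2_val].
HB.instance Definition _ := [Choice of Z2 by <:].
HB.instance Definition _ := [SubChoice_isSubLmodule of Z2 by <:].

Definition B2_pred : {pred Z2} := fun w => `[< is_coboundary2 (Z2_val w) >].

Lemma B2_closed : submod_closed B2_pred.
Proof.
split=> [|a w w' /asboolP[f [fl fe wE]] /asboolP[f' [fl' fe' wE']]];
    apply/asboolP.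
  exists (fun=> 0); split=> // [a x y|]; first by rewrite mulr0 addr0.
  by apply/funext => x; apply/funext => y; rewrite oppr0.
exists (fun x => a * f x + f' x); split=> [b x y|g x xg g1|].
- by rewrite fl fl'; ring.
- by rewrite (fe g) // (fe' g) // mulr0 addr0.
apply/funext => x; apply/funext => y.
transitivity (a * Z2_val w x y + Z2_val w' x y); first by [].
by rewrite wE wE'; ring.
Qed.
HB.instance Definition _ := GRing.isSubmodClosed.Build K Z2
  B2_pred (GRing.submod_closed_semi B2_closed).

Definition H2 : Type := modquot B2_pred.
HB.instance Definition _ := GRing.Lmodule.on H2.

Lemma H2_neq0P :
  (exists c : H2, c != 0) <->
  (exists2 w : L -> L -> K, is_cocycle2 w & ~ is_coboundary2 w).
Proof.
have pi0 (w : Z2) : modquot_pi B2_pred w = 0 <-> is_coboundary2 (Z2_val w).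
  rewrite -(raddf0 (modquot_pi B2_pred)) modquot_pi_eq subr0.
  by split=> /asboolP.
split=> [[c c0]|[w wZ wB]].
  have [w cE] := modquot_pi_surj c; case: w cE => w wZ cE.
  exists w; first exact/asboolP.
  by move=> wB; case/eqP: c0; rewrite cE; apply/pi0.
have wZ2 : (w : L -> L -> K^o) \in Z2_pred by apply/asboolP.
by exists (modquot_pi B2_pred (MkZ2 wZ2)); apply/eqP => /pi0.
Qed.
End Cohomology.

Section Deformation.
Variables (K : fieldType) (G : groupType) (A : algType K).
Variable comp : G -> submodClosed A.

(* A series a : nat -> A stands for \sum_n a n t^n in A[[t]]; a family of
   (bi)linear maps of A stands for the K[[t]]-(bi)linear map with these
   t-coefficients. *)
Definition series : Type := nat -> A.

Definition series_mul (m : nat -> A -> A -> A) (a b : series) : series :=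
  fun n => \sum_(i < n.+1) \sum_(j < (n - i).+1) m (n - i - j)%N (a i) (b j).

Definition series_map (f : nat -> A -> A) (a : series) : series :=
  fun n => \sum_(i < n.+1) f (n - i)%N (a i).

Definition linear_degree_e (f : A -> A) : Prop :=
  linear f /\ (forall g x, x \in comp g -> f x \in comp g).

Definition bilinear_degree_e (m : A -> A -> A) : Prop :=
  [/\ forall y, linear (m^~ y), forall x, linear (m x) &
      forall g h x y, x \in comp g -> y \in comp h -> m x y \in comp (g * h)%g].

Record graded_deformation (m : nat -> A -> A -> A) : Prop :=
    GradedDeformation {
  deformation_bilinear : forall n, bilinear_degree_e (m n);
  deformation_0 : m 0%N = *%R;
  deformation_assoc : associative (series_mul m)
}.

Definition equivalent_deformations (m m' : nat -> A -> A -> A) : Prop :=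
  exists (f : nat -> A -> A) (f_inv : series -> series),
    [/\ f 0%N = id, forall n, linear_degree_e (f n),
        cancel (series_map f) f_inv, cancel f_inv (series_map f) &
        forall a b : series, series_mul m' a b =
          f_inv (series_mul m (series_map f a) (series_map f b))].

Definition undeformed (n : nat) : A -> A -> A :=
  if n is 0 then *%R else fun _ _ => 0.

Definition trivial_deformation (m : nat -> A -> A -> A) : Prop :=
  equivalent_deformations m undeformed.
End Deformation.

(* Main.v *)
From HB Require Import structures.
Require Import Defs.
From mathcomp Require Import all_boot all_algebra.
From mathcomp Require Import boolp classical_sets wochoice.
From mathcomp Require Import finmap monalg.
From mathcomp Require Import ring zify.
Set Implicit Arguments.
Unset Strict Implicit.
Unset Printing Implicit Defensive.
Local Open Scope ring_scope.
Import GRing.Theory.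

(** A 2-cocycle [w] makes [E = L + K z], with [z] central of degree 1 and
bracket [[x, y] + w(x, y) z], into a color Lie algebra.  The image [t] of [z]
in U(E) is central and U(E) / (t) = U(L), so U(E) is a one-parameter family of
algebras whose fibre at [t = 0] is U(L).  As soon as [t] is not a zero divisor
in U(E), a graded linear section [s] of U(E) -> U(L) gives each element [a] of
U(E) a unique expansion [s(u_0) + t s(u_1) + ... + t^n s(u_n)] modulo
[t^(n+1)]: apply [a = s(pi a) + t (delta a)] repeatedly.  The coefficients of
the products [s(u) s(v)] then are the maps [m_n] of a graded deformation of
U(L) ([star_graded_deformation]); its associativity is that of U(E).

The non-trivial input is the theorem of Poincare, Birkhoff and Witt for color
Lie algebras ([pbw_span], [pbw_extend]): order a homogeneous basis of [E] with
[z] as its least element; left multiplication by [t] then maps standard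
monomials to standard monomials, and [s] and [delta] can be prescribed on them.
Spanning is straightening.  For independence one constructs, for any prescribed
values on standard words, a functional on all words which is compatible with
the rewriting rules [x_i x_j -> eps x_j x_i + [x_i, x_j]] for [i > j], and
[x_i x_i -> [x_i, x_i] / 2] for odd [i].  It is defined by always rewriting
the first descent, and compatibility with all other rewritings
([defect_descent]) is a confluence argument.  Two descents far apart commute
([defect_square]); two overlapping ones are reconciled by the Jacobi identity
([defect_hexagon]).  Both identities hold for repeated letters too, and then
the odd squares come out after dividing by 2 or by 3.

For non-triviality, suppose [id + t f_1 + ...] is an equivalence with the
undeformed product.  At order one, [m_1(u, v) = f_1(uv) - f_1(u) v - u f_1(v)].
For [x] and [y] homogeneous in L the color commutator of [m_1] at [x, y] is
[w(x, y) 1], while the augmentation U(L) -> K kills [x] and [y].  Hence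
[w(x, y)] is the value of the functional [aug f_1] at [[x, y]], and [w] would be
a coboundary ([star_trivial_coboundary]). *)

(** * Linear extension and well-orders *)

Lemma linear_at0 (K : pzRingType) (V W : lmodType K) (f : V -> W) :
  linear f -> f 0 = 0.
Proof. by move=> /(_ (-1) 0 0); rewrite !scaleN1r oppr0 addr0 addNr. Qed.

Section LinearExtension.
Variables (K : fieldType) (T : choiceType) (M : lmodType K) (phi : T -> M).

Definition lin_ext (p : {malg K[T]}) : M := \sum_(k <- msupp p) p@_k *: phi k.

Lemma lin_extEw (d : {fset T}) p : (msupp p `<=` d)%fset ->
  lin_ext p = \sum_(k <- d) p@_k *: phi k.
Proof.
move=> sub; rewrite /lin_ext (big_fset_incl _ sub) // => k _ kp.
by rewrite mcoeff_outdom ?scale0r.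
Qed.

Lemma lin_ext_linear : linear lin_ext.
Proof.
move=> a p q; pose d := (msupp p `|` msupp q)%fset.
have pd : (msupp p `<=` d)%fset by exact: fsubsetUl.
have qd : (msupp q `<=` d)%fset by exact: fsubsetUr.
have apd : (msupp (a *: p + q) `<=` d)%fset.
  apply: fsubset_trans (msuppD_le _ _) _; rewrite fsubUset qd andbT.
  exact: fsubset_trans (msuppZ_le _ _) pd.
rewrite (lin_extEw pd) (lin_extEw qd) (lin_extEw apd) scaler_sumr -big_split.
by apply: eq_bigr => k _ /=; rewrite mcoeffD mcoeffZ scalerDl scalerA.
Qed.
HB.instance Definition _ :=
  GRing.isLinear.Build K {malg K[T]} M *:%R lin_ext lin_ext_linear.

Lemma lin_extU k : lin_ext << k >> = phi k.
Proof.
rewrite (lin_extEw (d := [fset k]%fset)) ?msuppU_le //.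
by rewrite big_seq_fset1 mcoeffUU scale1r.
Qed.
End LinearExtension.

Lemma malg_lin_ind (K : fieldType) (T : choiceType) (P : {malg K[T]} -> Prop) :
  P 0 -> (forall a p q, P p -> P q -> P (a *: p + q)) ->
  (forall k, P << k >>) -> forall p, P p.
Proof.
move=> P0 Plin Pk p; rewrite [p]monalgE.
have PU a k : << a *g k >> = a *: << k >> :> {malg K[T]}.
  by apply/malgP => l; rewrite mcoeffZ !mcoeffU mulrnAr mulr1.
elim: (enum_fset _) => [|k s IHs]; rewrite ?big_nil // big_cons PU.
exact: Plin.
Qed.

Lemma well_order_total_order (T : eqType) (R : rel T) :
  well_order R -> total_order R.
Proof.
move=> Rwo; have Rch : wo_chain R predT by move=> A _; apply: Rwo.
have Rtot : total R by move=> x y; apply: (wo_chainW Rch).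
have Ranti : antisymmetric R.
  by move=> x y; apply: (wo_chain_antisymmetric Rch).
split=> //; split=> //; split=> [x|y x z xy yz]; first by rewrite -[R x x]orbb.
have [|m [[]]] := Rwo (mem [:: x; y; z]); first by exists x; rewrite mem_head.
rewrite !inE => mE mmin _.
have [mx my mz] : [/\ R m x, R m y & R m z].
  by split; apply: mmin; rewrite !inE eqxx ?orbT.
case/or3P: mE => /eqP mE; move: mx my mz; rewrite mE // => mx my mz.
  by rewrite (Ranti x y) ?xy.
by rewrite -(Ranti y z) ?yz.
Qed.

Lemma wo_ind (T : eqType) (R : rel T) (P : T -> Prop) : well_order R ->
  (forall x, (forall y, R y x -> y != x -> P y) -> P x) -> forall x, P x.
Proof.
move=> Rwo step x; apply: contrapT => nPx.
have [|z [[/asboolP nPz zmin] _]] := Rwo (fun y => `[< ~ P y >]).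
  by exists x; apply/asboolP.
apply: nPz; apply: step => y yz yNz; apply: contrapT => nPy.
have zy : R z y by apply: zmin; apply/asboolP.
by case/eqP: yNz; apply: (well_order_total_order Rwo).1.2; rewrite yz zy.
Qed.

Lemma lspan_ind (K : pzRingType) (V : lmodType K) (S : set V) (P : V -> Prop) :
  P 0 -> (forall a x y, P x -> P y -> P (a *: x + y)) ->
  (forall y, S y -> P y) -> forall x, x \in lspan S -> P x.
Proof.
move=> P0 Plin SP x.
have Pclosed : submod_closed (fun x => `[< P x >]).
  by split=> [|a y z /asboolP Py /asboolP Pz]; apply/asboolP; auto.
pose W : submodClosed V := HB.pack (fun x => `[< P x >])
  (GRing.isSubmodClosed.Build K V _ (GRing.submod_closed_semi Pclosed)).
by move=> /asboolP/(_ W) h; apply/asboolP/h => y Sy; apply/asboolP/SP.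
Qed.

(** Independence is the injectivity of [lin_ext e], and spanning makes its
inverse total: the map sought extends [phi] along that inverse. *)
Lemma basis_universal (K : fieldType) (V : lmodType K) (T : choiceType)
    (e : T -> V) :
  (forall x, x \in lspan (fun y => exists t, y = e t)) ->
  (forall p, lin_ext e p = 0 -> p = 0) ->
  forall (M : lmodType K) (phi : T -> M),
    exists f : {linear V -> M}, forall t, f (e t) = phi t.
Proof.
move=> e_span e_free M phi.
have e_surj x : exists p, lin_ext e p = x.
  move: x (e_span x); apply: lspan_ind => [|a y z [p <-] [q <-]|_ [t ->]].
  - by exists 0; rewrite raddf0.
  - by exists (a *: p + q); rewrite linearP.
  - by exists << t >>; rewrite lin_extU.
have [inv invK] := choice e_surj.
have inv_eq x p : lin_ext e p = x -> inv x = p.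
  move=> px; apply/eqP; rewrite -subr_eq0; apply/eqP/e_free.
  by rewrite linearB /= invK px subrr.
have f_lin : linear (fun x => lin_ext phi (inv x)).
  move=> a x y; rewrite -linearP; congr (lin_ext phi _); apply: inv_eq.
  by rewrite linearP /= !invK.
pose f : {linear V -> M} := HB.pack (fun x => lin_ext phi (inv x))
  (GRing.isLinear.Build K V M *:%R _ f_lin).
by exists f => t; rewrite /f /= (inv_eq _ << t >>) ?lin_extU.
Qed.

(** * Ordered homogeneous bases *)

Section HomogeneousBasis.
Variables (K : fieldType) (G : groupType) (eps : G -> G -> K).
Variable L : colorLieAlgebra eps.
Local Notation comp := (@color_comp K G eps L).

(** Independence is expressed as the universal property of a free module, the
only form in which coordinates with respect to the basis are used. *)
Record homogeneous_basis (I : choiceType) (le : rel I) (d : I -> G)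
    (b : I -> L) : Prop := HomogeneousBasis {
  basis_total : total le;
  basis_anti : antisymmetric le;
  basis_trans : transitive le;
  basis_comp : forall i, b i \in comp (d i);
  basis_span : forall g x, x \in comp g ->
    x \in lspan [set y | exists2 i, d i = g & y = b i];
  basis_extend : forall (M : lmodType K) (phi : I -> M),
    exists f : {linear L -> M}, forall i, f (b i) = phi i
}.

Lemma color_ind (W : submodClosed L) :
  (forall g x, x \in comp g -> x \in W) -> forall x, x \in W.
Proof.
move=> Wg x; have [/(_ x) [s [f [_ fg ->]]] _] := color_grading L.
by rewrite rpred_sum // => g _; apply: Wg (fg g).
Qed.

Lemma seq_max (T : eqType) (R : rel T) (s : seq T) :
  total R -> transitive R -> s != [::] ->
  exists2 m, m \in s & forall x, x \in s -> R x m.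
Proof.
move=> Rt Rtr; elim: s => // x s IHs _; case: (eqVneq s [::]) => [->|/IHs].
  by exists x; rewrite ?mem_head // => y; rewrite inE => /eqP ->;
     have := Rt x x; rewrite orbb.
case=> m ms mmax; have Rxx y : R y y by have := Rt y y; rewrite orbb.
have [xm|mx] := orP (Rt x m).
  exists m; rewrite ?inE ?ms ?orbT // => y.
  by rewrite inE => /orP[/eqP ->|/mmax].
exists x; rewrite ?mem_head // => y; rewrite inE => /orP[/eqP -> //|/mmax ym].
exact: Rtr ym mx.
Qed.

(** Well-order all pairs [(g, x)] and keep those with [x] of degree [g] which
is not in the span of the earlier vectors of degree [g].  This yields the basis
and its order at once: spanning is well-founded induction, and a dependency is
refuted at its greatest index. *)
Lemma homogeneous_basis_exists :
  exists (I : choiceType) (le : rel I) (d : I -> G) (b : I -> L),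
    homogeneous_basis le d b.
Proof.
have [R Rwo] := well_ordering_principle (G * L)%type.
have [[[_ Rtr] Ranti] Rtot] := well_order_total_order Rwo.
pose below g x (y : L) := [/\ y \in comp g, R (g, y) (g, x) & y != x].
pose ind (p : G * L) :=
  (p.2 \in comp p.1) && (p.2 \notin lspan (below p.1 p.2)).
pose I : choiceType := {p : G * L | ind p}.
pose d (i : I) := (val i).1; pose b (i : I) := (val i).2.
pose le (i j : I) := R (val i) (val j).
have bcomp i : b i \in comp (d i) by have /andP[] := valP i.
have bnot i : b i \notin lspan (below (d i) (b i)).
  by have /andP[] := valP i.
have bspan g x : x \in comp g ->
    x \in lspan [set y | exists2 i, d i = g & y = b i].
  pose P (p : G * L) := p.1 = g -> p.2 \in comp g ->
    p.2 \in lspan [set y | exists2 i, d i = g & y = b i].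
  suff /(_ (g, x)) : forall p, P p by apply.
  apply: (wo_ind Rwo) => -[h {}x] IH; rewrite /P /= => hg; subst h => xg.
  have [xI|] := boolP (ind (g, x)).
    by apply: lspan_sub; exists (Sub (g, x) xI).
  rewrite /ind /= xg /= negbK; apply: lspan_min => y [yg yx yNx].
  by apply: (IH (g, y)) => //; rewrite xpair_eqE eqxx.
pose ev : {linear {malg K[I]} -> L} := lin_ext b.
have ev_inj p : ev p = 0 -> p = 0.
  move=> evp0; apply/malgP => k0; rewrite mcoeff0; apply/eqP.
  rewrite mcoeff_eq0; apply/negP => k0p.
  pose F k := p@_k *: b k.
  pose s := undup [seq d k | k <- msupp p].
  have Fg g : \sum_(k <- msupp p | d k == g) F k \in comp g.
    by rewrite rpred_sum // => k /eqP <-; rewrite rpredZ.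
  have ds k : k \in msupp p -> d k \in s.
    by move=> kp; rewrite mem_undup map_f.
  have hom0 : \sum_(k <- msupp p | d k == d k0) F k = 0.
    have [_ /(_ s (fun g => \sum_(k <- msupp p | d k == g) F k))] :=
      color_grading L.
    apply=> //; rewrite ?undup_uniq ?ds //.
    rewrite (exchange_big_dep predT) //= -[RHS]evp0 /ev /= /lin_ext.
    rewrite big_seq_cond [RHS]big_seq_cond; apply: eq_bigr => k /andP[kp _].
    rewrite (eq_bigl (pred1 (d k))) => [|g]; last by rewrite /= eq_sym.
    by rewrite -big_filter filter_pred1_uniq ?undup_uniq ?ds // big_seq1.
  (* The vector of greatest index in a homogeneous dependency is a combination
     of earlier ones. *)
  have [|||m] := @seq_max I le [seq k <- msupp p | d k == d k0].
  - by move=> i j; apply: Rtot.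
  - by move=> i j k; apply: Rtr.
  - by apply/eqP => /(congr1 (fun r => k0 \in r)); rewrite mem_filter eqxx k0p.
  rewrite mem_filter => /andP[/eqP dm mp] mmax.
  case/negP: (bnot m); have pm0 : p@_m != 0 by rewrite mcoeff_neq0.
  have bm : b m = - (p@_m)^-1 *:
      \sum_(k <- msupp p | (d k == d k0) && (k != m)) F k.
    move: hom0; rewrite -big_filter (bigD1_seq m) ?filter_uniq //=; last first.
      by rewrite mem_filter dm eqxx.
    rewrite big_filter_cond => /eqP; rewrite addr_eq0 => /eqP.
    by rewrite scaleNr -scalerN => <-; rewrite scalerA mulVf ?scale1r.
  rewrite [X in X \in _]bm rpredZ // big_seq_cond.
  rewrite rpred_sum // => k /and3P[kp /eqP dk km].
  rewrite rpredZ //; apply: lspan_sub; split; first by rewrite dm -dk.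
    have := mmax k; rewrite mem_filter kp dk eqxx => /(_ isT).
    by rewrite /le /b dm -dk -surjective_pairing dk -dm -surjective_pairing.
  apply: contraNneq km => bkm; apply/eqP/val_inj.
  by rewrite [LHS]surjective_pairing [RHS]surjective_pairing -/(b k) -/(b m)
    -/(d k) -/(d m) bkm dk dm.
exists I, le, d, b; split=> //.
- by move=> i j; apply: Rtot.
- by move=> i j ij; apply/val_inj/Ranti.
- by move=> i j k; apply: Rtr.
apply: basis_universal ev_inj => x; move: x; apply: color_ind => g x /bspan.
by apply: lspan_min => y [i _ ->]; apply: lspan_sub; exists i.
Qed.
End HomogeneousBasis.

(** * Words and descents *)

Section Words.
Variables (I : choiceType) (le : rel I) (odd : pred I).
Hypotheses (le_total : total le) (le_anti : antisymmetric le)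
  (le_trans : transitive le).
Implicit Types (i j k : I) (u v w : seq I).

(** A descent is a pair of adjacent letters to which a rewriting rule applies:
out of order, or an odd letter repeated. *)
Definition is_descent i j := ~~ le i j || ((i == j) && odd i).

(** These words index the monomials of a Poincare-Birkhoff-Witt basis. *)
Definition is_standard w := sorted (fun i j => ~~ is_descent i j) w.

Fixpoint inversions w : nat :=
  if w is i :: w' then (count (fun j => ~~ le i j) w' + inversions w')%N
  else 0%N.

Fixpoint first_descent w : option (seq I * I * I * seq I) :=
  if w is i :: w' then
    if w' is j :: v then
      if is_descent i j then Some ([::], i, j, v)
      else omap (fun p => (i :: p.1.1.1, p.1.1.2, p.1.2, p.2))
             (first_descent w')
    else None
  else None.

Lemma le_refl i : le i i.
Proof. by have := le_total i i; rewrite orbb. Qed.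

Lemma descentW i j : is_descent i j -> le j i.
Proof.
by case/orP=> [/negbTE ij|/andP[/eqP -> _]]; rewrite ?le_refl //;
  have := le_total i j; rewrite ij.
Qed.

Lemma descent_trans i j k : is_descent i j -> is_descent j k -> is_descent i k.
Proof.
move=> ij jk; have [ik|//] := boolP (le i k); last by rewrite /is_descent => ->.
have ikE : i = k.
  by apply: le_anti; rewrite ik (le_trans (descentW jk) (descentW ij)).
have jiE : j = i.
  by apply: le_anti; rewrite (descentW ij) ikE (descentW jk).
by move: ij; rewrite jiE ikE.
Qed.

Lemma inversions_swap u i j v : ~~ le i j ->
  inversions (u ++ i :: j :: v) = (inversions (u ++ j :: i :: v)).+1.
Proof.
move=> ij; have ji : le j i by have := le_total i j; rewrite (negbTE ij).
elim: u => [|k u IHu] /=; first by rewrite ij ji; lia.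
by rewrite IHu !count_cat /=; lia.
Qed.

Lemma first_descent_cons i j w : first_descent (i :: j :: w) =
  if is_descent i j then Some ([::], i, j, w)
  else omap (fun p => (i :: p.1.1.1, p.1.1.2, p.1.2, p.2))
         (first_descent (j :: w)).
Proof. by []. Qed.
#[global] Arguments first_descent : simpl never.

Lemma first_descent_some w u i j v : first_descent w = Some (u, i, j, v) ->
  w = u ++ i :: j :: v /\ is_descent i j.
Proof.
elim: w u i j v => // k [|l w] // IHw u i j v; rewrite first_descent_cons.
case: ifP => [kl [<- <- <- <-] //|_].
case E: (first_descent _) => [[[[u' i'] j'] v']|] //= [<- <- <- <-].
by have [-> ?] := IHw _ _ _ _ E.
Qed.

Lemma first_descent_none w : first_descent w = None -> is_standard w.
Proof.
rewrite /is_standard; case: w => // i w.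
elim: w i => // j w IHw i; rewrite first_descent_cons.
case: ifP => //= -> /=; move: (IHw j).
by case: (first_descent (j :: w)) => [//|/(_ erefl)].
Qed.

Lemma standard_first_descent w : is_standard w -> first_descent w = None.
Proof.
rewrite /is_standard; case: w => // i w /=.
elim: w i => // j w IHw i /= /andP[/negbTE ij jw].
by rewrite first_descent_cons ij IHw.
Qed.

(** The three positions of an arbitrary descent relative to the first one (the
same, overlapping on one letter, disjoint) are the cases of the confluence
argument. *)
Lemma first_descent_cat u i j v : is_descent i j ->
  exists u0 i0 j0 v0,
    [/\ first_descent (u ++ i :: j :: v) = Some (u0, i0, j0, v0),
        is_descent i0 j0 &
     [\/ [/\ u = u0, i = i0, j = j0 & v = v0],
         u = rcons u0 i0 /\ (j0 = i /\ v0 = j :: v) |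
         exists2 m, u = u0 ++ i0 :: j0 :: m & v0 = m ++ i :: j :: v]].
Proof.
move=> ij; elim: u => [|k u IHu].
  exists [::], i, j, v; rewrite first_descent_cons ij.
  by split=> //; constructor 1.
have [l [w uE]] : exists l w, u ++ i :: j :: v = l :: w.
  by case: (u) => [|l u']; [exists i, (j :: v) | exists l, (u' ++ i :: j :: v)].
rewrite cat_cons uE first_descent_cons -uE; case: ifP => kl.
  exists [::], k, l, w; split=> //.
  case: u {IHu} uE => [[<- <-]|l' u [-> <-]]; first by constructor 2.
  by constructor 3; exists u.
have [u0 [i0 [j0 [v0 [-> d0 cases]]]]] := IHu.
exists (k :: u0), i0, j0, v0; split=> //.
case: cases => [[-> -> -> ->]|[-> [-> ->]]|[m -> ->]].
- by constructor 1.
- by constructor 2.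
- by constructor 3; exists m.
Qed.
End Words.

(** * Bracket and bicharacter identities *)

Section ColorBracket.
Variables (K : fieldType) (G : groupType) (eps : G -> G -> K).
Variable L : colorLieAlgebra eps.
Local Notation comp := (@color_comp K G eps L).
Local Notation br := (@color_br K G eps L).
Hypothesis eps_bichar : antisym_bicharacter eps.

Lemma color_br0l y : br 0 y = 0.
Proof. exact: linear_at0 (color_br_linearl y). Qed.

Lemma color_br0r x : br x 0 = 0.
Proof. exact: linear_at0 (color_br_linearr x). Qed.

Lemma color_brZr a x y : br x (a *: y) = a *: br x y.
Proof. by rewrite -[a *: y]addr0 color_br_linearr color_br0r addr0. Qed.

(** The Jacobi identity with all brackets nested to the left, in the form of
the cocycle condition. *)
Lemma color_jacobi_left g h k x y z :
    x \in comp g -> y \in comp h -> z \in comp k ->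
  br (br x y) z - eps h k *: br (br x z) y
    + (eps g h * eps g k) *: br (br y z) x = 0.
Proof.
move=> xg yh zk; have J := color_br_jacobi xg yh zk.
have xy := color_br_comp xg yh; have xz := color_br_comp xg zk.
have yz := color_br_comp yh zk.
have zx : br z x = - eps k g *: br x z.
  by rewrite (color_br_antisym zk xg) scaleNr.
have xyz : br x (br y z) = (- (eps g h * eps g k)) *: br (br y z) x.
  by rewrite (color_br_antisym xg yz) (bicharMr eps_bichar) scaleNr.
have yxz : br y (br x z) = (- (eps h g * eps h k)) *: br (br x z) y.
  by rewrite (color_br_antisym yh xz) (bicharMr eps_bichar) scaleNr.
have zxy : br z (br x y) = (- (eps k g * eps k h)) *: br (br x y) z.
  by rewrite (color_br_antisym zk xy) (bicharMr eps_bichar) scaleNr.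
move: J; rewrite zx color_brZr xyz yxz zxy !scalerA.
have gk := bichar_antisym eps_bichar g k.
have gh := bichar_antisym eps_bichar g h.
have hk := bichar_antisym eps_bichar h k.
have -> : eps k g * - (eps g h * eps g k) = - (eps k g * (eps g h * eps g k)).
  by ring.
have -> : eps g h * - eps k g * - (eps h g * eps h k) = eps k g * eps h k.
  transitivity ((eps g h * eps h g) * (eps k g * eps h k)); first by ring.
  by rewrite gh mul1r.
have -> : eps h k * - (eps k g * eps k h) = - eps k g.
  transitivity (- ((eps h k * eps k h) * eps k g)); first by ring.
  by rewrite hk mul1r.
move=> /(congr1 ( *:%R (- eps g k))); rewrite scaler0 !scalerDr !scalerA.
have -> : - eps g k * - (eps k g * (eps g h * eps g k)) = eps g h * eps g k.
  transitivity ((eps g k * eps k g) * (eps g h * eps g k)); first by ring.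
  by rewrite gk mul1r.
have -> : - eps g k * (eps k g * eps h k) = - eps h k.
  transitivity (- ((eps g k * eps k g) * eps h k)); first by ring.
  by rewrite gk mul1r.
rewrite mulrNN gk scale1r scaleNr => <-.
by rewrite [RHS]addrC addrA [RHS]addrAC.
Qed.

Lemma bichar_self g : (eps g g == 1) || (eps g g == -1).
Proof. by rewrite -eqf_sqr expr2 expr1n bichar_antisym. Qed.

Lemma bichar1l g : eps 1%g g = 1.
Proof.
have := bicharMl eps_bichar 1%g 1%g g; rewrite mul1g => E.
by apply: (mulIf (bichar_neq0 eps_bichar 1%g g)); rewrite mul1r -E.
Qed.

Lemma bichar1r g : eps g 1%g = 1.
Proof. by have := bichar_antisym eps_bichar g 1%g; rewrite bichar1l mulr1. Qed.
End ColorBracket.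

(** * The normal form functional on words *)

Section NormalForm.
Variables (K : fieldType) (G : groupType) (eps : G -> G -> K).
Variable L : colorLieAlgebra eps.
Local Notation comp := (@color_comp K G eps L).
Local Notation br := (@color_br K G eps L).
Hypothesis charK0 : [pchar K] =i pred0.
Hypothesis eps_bichar : antisym_bicharacter eps.
Variables (I : choiceType) (le : rel I) (d : I -> G) (b : I -> L).
Hypothesis bP : homogeneous_basis le d b.
Implicit Types (i j k l : I) (u v w m : seq I) (x y z : L).

Definition odd_index : pred I := fun i => eps (d i) (d i) != 1.
Local Notation q i j := (eps (d i) (d j)).
Local Notation descent := (is_descent le odd_index).
Local Notation inv := (inversions le).

Lemma natr_neq0 n : n.+1%:R != 0 :> K.
Proof. by rewrite ((pcharf0P K).1 charK0). Qed.

Lemma natr_mulI n (x : K) : n.+1%:R * x = 0 -> x = 0.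
Proof. by move/eqP; rewrite mulf_eq0 (negbTE (natr_neq0 n)) => /eqP. Qed.

Lemma odd_indexE i : odd_index i -> q i i = -1.
Proof.
rewrite /odd_index.
by have /orP[/eqP ->|/eqP ->] := bichar_self eps_bichar (d i); rewrite ?eqxx.
Qed.

Lemma basis_ind (P : L -> Prop) :
  P 0 -> (forall a x y, P x -> P y -> P (a *: x + y)) ->
  (forall i, P (b i)) -> forall x, P x.
Proof.
move=> P0 Plin Pb x.
have [/(_ x) [s [f [_ fg ->]]] _] := color_grading L.
have Pg g : P (f g).
  move: (basis_span bP (fg g)); apply: lspan_ind => // _ [i _ ->] //.
elim/big_ind: _ => // y z Py Pz; rewrite -[y]scale1r; exact: Plin.
Qed.

Lemma basis_comp_ind g (P : L -> Prop) :
  P 0 -> (forall a x y, P x -> P y -> P (a *: x + y)) ->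
  (forall i, d i = g -> P (b i)) -> forall x, x \in comp g -> P x.
Proof.
move=> P0 Plin Pb x /(basis_span bP); apply: lspan_ind => // _ [i di ->].
exact: Pb.
Qed.

Definition basis_ext (phi : I -> K) : L -> K :=
  sval (cid (@basis_extend _ _ _ _ _ _ _ _ bP K^o phi)).

Lemma basis_extE phi i : basis_ext phi (b i) = phi i.
Proof. exact: (svalP (cid (basis_extend bP (M := K^o) phi))). Qed.

Lemma basis_extP phi a x y :
  basis_ext phi (a *: x + y) = a * basis_ext phi x + basis_ext phi y.
Proof. exact: linearP. Qed.

Lemma basis_ext0 phi : basis_ext phi 0 = 0.
Proof. exact: linear0. Qed.

Lemma basis_extZ phi a x : basis_ext phi (a *: x) = a * basis_ext phi x.
Proof. by rewrite -[a *: x]addr0 basis_extP basis_ext0 addr0. Qed.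

Lemma basis_extD phi x y :
  basis_ext phi (x + y) = basis_ext phi x + basis_ext phi y.
Proof. by rewrite -[x]scale1r basis_extP mul1r scale1r. Qed.

Variable phi : seq I -> K.

(** The linear extension of [f] in one letter of a word, which gives a meaning
to words one letter of which is replaced by a vector of [L]. *)
Definition slot (f : seq I -> K) u v : L -> K :=
  basis_ext (fun k => f (u ++ k :: v)).

Lemma slotE f u v i : slot f u v (b i) = f (u ++ i :: v).
Proof. exact: basis_extE. Qed.

Lemma slotP f u v a x y :
  slot f u v (a *: x + y) = a * slot f u v x + slot f u v y.
Proof. exact: basis_extP. Qed.

Lemma slot0 f u v : slot f u v 0 = 0.
Proof. exact: basis_ext0. Qed.

Lemma slotZ f u v a x : slot f u v (a *: x) = a * slot f u v x.
Proof. exact: basis_extZ. Qed.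

Lemma slotD f u v x y : slot f u v (x + y) = slot f u v x + slot f u v y.
Proof. exact: basis_extD. Qed.

(** [straighten lower n] rewrites first descents as long as the fuel [n] lasts;
the bracket terms, shorter by one letter, are left to [lower]. *)
Fixpoint straighten (lower : seq I -> K) n w : K :=
  if n is n'.+1 then
    if first_descent le odd_index w is Some (u, i, j, v) then
      if i == j then 2%:R^-1 * slot lower u v (br (b i) (b i))
      else q i j * straighten lower n' (u ++ j :: i :: v)
           + slot lower u v (br (b i) (b j))
    else phi w
  else phi w.

(** The fuel is one more than the number of inversions: each exchange of letters
removes one inversion, and the last step may be the square of an odd letter. *)
Fixpoint normal_form_size n : seq I -> K :=
  if n is n'.+1 then fun w => straighten (normal_form_size n') (inv w).+1 w
  else phi.

Definition normal_form w := normal_form_size (size w) w.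
Local Notation nf := normal_form.

Lemma slot_size n u v : (size u + size v)%N = n ->
  slot (normal_form_size n.+1) u v = slot nf u v.
Proof.
move=> un; rewrite /slot; congr basis_ext; apply/funext => k.
by rewrite /nf size_cat /= addnS un.
Qed.

Lemma normal_form_standard w : is_standard le odd_index w -> nf w = phi w.
Proof.
move=> ws; rewrite /nf; case: w ws => // i w ws.
by rewrite /= (standard_first_descent ws).
Qed.

(** The failure of the functional to respect the defining relation of the
enveloping algebra at one position of a word. *)
Definition defect u i j v : K :=
  nf (u ++ i :: j :: v) - q i j * nf (u ++ j :: i :: v)
    - slot nf u v (br (b i) (b j)).

(** At the first descent the relation holds by construction; for an odd square
this is where the factor 1/2 comes from. *)
Lemma defect_first u i j v :
  first_descent le odd_index (u ++ i :: j :: v) = Some (u, i, j, v) ->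
  defect u i j v = 0.
Proof.
move=> fd; have [_ ij] := first_descent_some fd.
have sz : size (u ++ i :: j :: v) = (size u + size v).+2%N.
  by rewrite size_cat /= !addnS.
have nfE : nf (u ++ i :: j :: v) =
   if i == j then 2%:R^-1 * slot nf u v (br (b i) (b i))
   else q i j * nf (u ++ j :: i :: v) + slot nf u v (br (b i) (b j)).
  rewrite {1}/nf sz /= fd slot_size //; case: eqVneq => // iNj.
  have ijN : ~~ le i j by move: ij; rewrite /is_descent (negbTE iNj) orbF.
  rewrite /nf size_cat /= !addnS /= (inversions_swap (basis_total bP)) //.
rewrite /defect nfE; case: eqVneq ij nfE => [<-|iNj _ _]; last by ring.
rewrite /is_descent (le_refl (basis_total bP)) eqxx /= => /odd_indexE qii ->.
rewrite qii.
have -> : forall s : K, 2%:R^-1 * s - -1 * (2%:R^-1 * s) - s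
    = (2%:R^-1 * 2%:R - 1) * s by move=> s; ring.
by rewrite mulVf ?natr_neq0 // subrr mul0r.
Qed.

Lemma defect_antisym u i j v : defect u i j v = - (q i j * defect u j i v).
Proof.
rewrite /defect (color_br_antisym (basis_comp bP i) (basis_comp bP j)).
rewrite -scaleN1r scalerA /slot basis_extZ.
have e := bichar_antisym eps_bichar (d i) (d j).
move: (nf _) (nf _) (basis_ext _ _) => B A C.
apply: subr0_eq; transitivity ((1 - q i j * q j i) * A); first by ring.
by rewrite e subrr mul0r.
Qed.

Lemma defect_even u i v : ~~ odd_index i -> defect u i i v = 0.
Proof.
rewrite negbK => /eqP qii; have := defect_antisym u i i v.
rewrite qii mul1r => /eqP; rewrite -addr_eq0 -mulr2n -mulr_natl mulf_eq0.
by rewrite (negbTE (natr_neq0 1)) => /eqP.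
Qed.

(** In this section the relations hold for words one letter shorter than the
words considered, hence in every slot by linearity. *)
Section Confluence.
Variable N : nat.
Hypothesis defect0 : forall u i j v, (size u + size v).+1 = N ->
  defect u i j v = 0.

Lemma slot_right u m k l v x : (size u + size m + size v).+2 = N ->
  slot nf u (m ++ k :: l :: v) x = q k l * slot nf u (m ++ l :: k :: v) x
    + basis_ext (fun p => slot nf (u ++ p :: m) v (br (b k) (b l))) x.
Proof.
move=> sz; move: x; apply: basis_ind => [|a x y xE yE|i].
- by rewrite !slot0 basis_ext0; ring.
- by rewrite !slotP basis_extP xE yE; ring.
rewrite !slotE basis_extE; apply: subr0_eq.
rewrite -[RHS](@defect0 (u ++ i :: m) k l (v)).
  by rewrite /defect -!catA /=; ring.
by rewrite size_cat /=; lia.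
Qed.

Lemma slot_left u i j m v y : (size u + size m + size v).+2 = N ->
  slot nf (u ++ i :: j :: m) v y = q i j * slot nf (u ++ j :: i :: m) v y
    + basis_ext (fun p => slot nf u (m ++ p :: v) (br (b i) (b j))) y.
Proof.
move=> sz; move: y; apply: basis_ind => [|a x y xE yE|k].
- by rewrite !slot0 basis_ext0; ring.
- by rewrite !slotP basis_extP xE yE; ring.
rewrite !slotE basis_extE; apply: subr0_eq.
rewrite -[RHS](@defect0 (u) i j (m ++ k :: v)).
  by rewrite /defect -!catA /=; ring.
by rewrite size_cat /=; lia.
Qed.

(** Extending linearly in two letters of a word does not depend on the order. *)
Lemma slot_slot u m v x y :
  basis_ext (fun p => slot nf (u ++ p :: m) v y) x =
  basis_ext (fun r => slot nf u (m ++ r :: v) x) y.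
Proof.
move: x; apply: basis_ind => [|a x z xE zE|i].
- rewrite basis_ext0; move: y; apply: basis_ind => [|a y z yE zE|i].
  + by rewrite basis_ext0.
  + by rewrite basis_extP -yE -zE mulr0 addr0.
  + by rewrite basis_extE slot0.
- rewrite basis_extP xE zE; move: y {xE zE}.
  apply: basis_ind => [|c y t yE tE|i].
  + by rewrite !basis_ext0; ring.
  + by rewrite !basis_extP -yE -tE; ring.
  + by rewrite !basis_extE slotP.
rewrite basis_extE; move: y; apply: basis_ind => [|a y z yE zE|j].
- by rewrite slot0 basis_ext0.
- by rewrite slotP basis_extP -yE -zE.
- by rewrite slotE basis_extE slotE -catA.
Qed.

(** Both ways around the square of exchanges at two disjoint positions end at
the same word, so the defects differ by shorter words only, where the relations
hold. *)
Lemma defect_square u i j m k l v : (size u + size m + size v).+2 = N ->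
  defect u i j (m ++ k :: l :: v) + q i j * defect (u ++ j :: i :: m) k l v
  = defect (u ++ i :: j :: m) k l v + q k l * defect u i j (m ++ l :: k :: v).
Proof.
move=> sz; rewrite /defect slot_right // (@slot_left u i j) // slot_slot.
by rewrite -!catA /=; ring.
Qed.

(** The relation at two adjacent letters, the first of which is a homogeneous
vector; in the hexagon this vector is itself a bracket. *)
Lemma slot_bracket u k v g x : x \in comp g -> (size u + size v).+1 = N ->
  slot nf u (k :: v) x =
    eps g (d k) * slot nf (rcons u k) v x + slot nf u v (br x (b k)).
Proof.
move=> xg sz; move: x xg; apply: basis_comp_ind => [|a x y xE yE|i <-].
- by rewrite color_br0l !slot0; ring.
- by rewrite color_br_linearl !slotP xE yE; ring.
rewrite !slotE; apply: subr0_eq.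
rewrite -[RHS](@defect0 (u) i k (v)) //.
by rewrite /defect cat_rcons; ring.
Qed.

(** The two reduced decompositions of the permutation reversing three letters
both end at [k j i].  The bracket terms collected along the two paths differ by
the Jacobi identity.  The letters need not be distinct. *)
Lemma defect_hexagon u i j k v : (size u + size v).+1 = N ->
  defect u i j (k :: v) + q i j * defect (rcons u j) i k v
    + q i j * q i k * defect u j k (i :: v)
  = defect (rcons u i) j k v + q j k * defect u i k (j :: v)
    + q j k * q i k * defect (rcons u k) i j v.
Proof.
move=> sz; have bc := basis_comp bP.
have ij := color_br_comp (bc i) (bc j); have ik := color_br_comp (bc i) (bc k).
have jk := color_br_comp (bc j) (bc k).
have J := color_jacobi_left eps_bichar (bc i) (bc j) (bc k).
have := congr1 (slot nf u v) J.
rewrite -scaleN1r scalerA !slotD !slotZ slot0.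
have := slot_bracket k ij sz; have := slot_bracket j ik sz.
have := slot_bracket i jk sz.
rewrite !(bicharMl eps_bichar).
have eij := bichar_antisym eps_bichar (d i) (d j).
have eik := bichar_antisym eps_bichar (d i) (d k).
have ejk := bichar_antisym eps_bichar (d j) (d k).
rewrite /defect !cat_rcons.
move=> E1 E2 E3 {}J; rewrite E1 E2 E3; apply: subr0_eq; rewrite -[RHS]oppr0 -J.
set Ri := slot _ (rcons u i) v _; set Rj := slot _ (rcons u j) v _.
transitivity ((1 - (q i j * q j i) * (q i k * q k i)) * Ri
    + q i j * (q j k * q k j - 1) * Rj
    - (slot nf u v (br (br (b i) (b j)) (b k))
       + -1 * q j k * slot nf u v (br (br (b i) (b k)) (b j))
       + q i j * q i k * slot nf u v (br (br (b j) (b k)) (b i)))).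
  by rewrite -/Ri -/Rj; ring.
by rewrite eij eik ejk mulr1 subrr mulr0 !mul0r !add0r.
Qed.
End Confluence.

(** Induction on the number of inversions: the first descent has no defect, and
the square or the hexagon transports this to any other descent.  Exchanging two
equal letters does not decrease the number of inversions, so with odd repeated
letters the unknown defect occurs several times in the identity; it then
vanishes because 2 and 3 are invertible. *)
Lemma defect_descent u i j v :
  (forall u' i' j' v', (size u' + size v').+1 = (size u + size v)%N ->
     defect u' i' j' v' = 0) ->
  descent i j -> defect u i j v = 0.
Proof.
have [c] := ubnP (inv (u ++ i :: j :: v)).
elim: c => // c IHc in u i j v *; rewrite ltnS => inv_c lower ij.
have IH u' i' j' v' : (size u' + size v' = size u + size v)%N ->
    (inv (u' ++ i' :: j' :: v') < inv (u ++ i :: j :: v))%N ->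
    descent i' j' -> defect u' i' j' v' = 0.
  by move=> sz lt; apply: IHc; [exact: leq_trans lt inv_c | rewrite sz].
have swap := inversions_swap (basis_total bP).
have swap2 u' k (x y : I) v' : ~~ le x y -> inv (u' ++ k :: x :: y :: v') =
    (inv (u' ++ k :: y :: x :: v')).+1.
  by move=> xy; rewrite -[_ ++ k :: x :: _]cat_rcons
    -[_ ++ k :: y :: _]cat_rcons swap.
have trans := descent_trans (basis_total bP) (basis_anti bP) (basis_trans bP).
have descentN i' j' : descent i' j' -> i' != j' -> ~~ le i' j'.
  by rewrite /is_descent => + /negbTE iNj; rewrite iNj orbF.
have odd_eq i' : descent i' i' -> q i' i' = -1.
  by rewrite /is_descent (le_refl (basis_total bP)) eqxx => /odd_indexE.
have [u0 [i0 [j0 [v0 [fd d0 cases]]]]] := first_descent_cat u v ij.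
case: cases fd d0 => [[-> -> -> ->]|[uE [-> ->]]|[m uE ->]] fd d0.
- exact: defect_first fd.
- rewrite uE !cat_rcons size_rcons in fd IH lower *.
  have X0 := defect_first fd.
  have hex := defect_hexagon lower i0 i j (erefl : (size u0 + size v).+1 = _).
  rewrite X0 add0r in hex; move: hex.
  have ai := d0; have aj := trans _ _ _ _ ai ij.
  have := descentN _ _ ai; have := descentN _ _ ij; have := descentN _ _ aj.
  case: (eqVneq i0 i) X0 IH ai aj => [->|aNi] X0 IH ai aj;
    case: (eqVneq i j) ij X0 IH aj => [<-|iNj] ij X0 IH aj.
  + move=> _ _ _; rewrite X0 (odd_eq _ ai) => hex; apply: (@natr_mulI 2).
    by move/eqP: hex; rewrite -subr_eq0 => /eqP e; rewrite -[RHS]oppr0 -e; ring.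
  + move=> /(_ isT) le_ij _ _; rewrite (odd_eq _ ai).
    rewrite (IH u0 i j (i :: v)) //=; last 2 first.
    - by rewrite addnS.
    - by rewrite [X in (_ < X)%N]swap2.
    rewrite (IH (rcons u0 j)) //; last 2 first.
    - by rewrite size_rcons.
    - by rewrite cat_rcons [X in (_ < X)%N]swap2 // ltnS [X in (_ <= X)%N]swap.
    move=> hex; apply: (@natr_mulI 1).
    by move/eqP: hex; rewrite -subr_eq0 => /eqP e; rewrite -[RHS]oppr0 -e; ring.
  + move=> _ _ /(_ isT) le_ai; rewrite X0.
    rewrite (IH (rcons u0 i)) //; last 2 first.
    - by rewrite size_rcons.
    - by rewrite cat_rcons [X in (_ < X)%N]swap.
    rewrite (IH u0 i i (i0 :: v)) //=; last 2 first.
    - by rewrite addnS.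
    - by rewrite [X in (_ < X)%N]swap // ltnS [X in (_ <= X)%N]swap2.
    by rewrite !mulr0 !addr0 => /esym.
  + have aNj : i0 != j.
      apply: contraNneq aNi => aj'; apply/eqP/(basis_anti bP).
      rewrite (descentW (basis_total bP) ai) andbT {1}aj'.
      exact: (descentW (basis_total bP) ij).
    move=> /(_ aNj) le_aj /(_ isT) le_ij /(_ isT) le_ai.
    rewrite (IH (rcons u0 i)) //; last 2 first.
    - by rewrite size_rcons.
    - by rewrite cat_rcons [X in (_ < X)%N]swap.
    rewrite (IH u0 i j (i0 :: v)) //=; last 2 first.
    - by rewrite addnS.
    - by rewrite [X in (_ < X)%N]swap // ltnS [X in (_ <= X)%N]swap2.
    rewrite (IH u0 i0 j (i :: v)) //=; last 2 first.
    - by rewrite addnS.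
    - by rewrite [X in (_ < X)%N]swap2.
    rewrite (IH (rcons u0 j)) //; last 2 first.
    - by rewrite size_rcons.
    - by rewrite cat_rcons [X in (_ < X)%N]swap2 // ltnS [X in (_ <= X)%N]swap.
    by rewrite !mulr0 !addr0 => /esym.
rewrite uE -!catA /= in fd IH lower *.
have X0 := defect_first fd.
have sz : (size u0 + size m + size v).+2%N =
    (size (u0 ++ [:: i0, j0 & m]) + size v)%N by rewrite size_cat /=; lia.
have sq := @defect_square _ lower u0 i0 j0 m i j v sz.
have X'0 : defect u0 i0 j0 (m ++ j :: i :: v) = 0.
  case: (eqVneq i j) => [ijE|iNj]; first by move: X0; rewrite ijE.
  apply: IH => //; first by rewrite -sz !size_cat /=; lia.
  rewrite [X in (_ < X)%N](_ : _ = inv ((u0 ++ i0 :: j0 :: m) ++ i :: j :: v)).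
    by rewrite [X in (_ < X)%N]swap ?descentN // -catA.
  by rewrite -catA.
move: sq; rewrite X0 X'0 add0r mulr0 addr0.
have [j0E|i0N] := eqVneq i0 j0.
  rewrite -j0E in d0 *; rewrite (odd_eq _ d0) mulN1r => /esym YE.
  apply: (@natr_mulI 1); move/eqP: YE; rewrite -subr_eq0 => /eqP e.
  by rewrite -[RHS]e; ring.
rewrite [X in _ * X = _]IH ?mulr0 //; first by rewrite -sz !size_cat /=; lia.
by rewrite -catA /= [X in (_ < X)%N]swap ?descentN.
Qed.

(** At a non-descent, exchange the two letters; an even letter repeated has no
defect because its self-bracket is antisymmetric, hence zero. *)
Lemma defect_eq0 u i j v : defect u i j v = 0.
Proof.
have [n] := ubnP (size u + size v); elim: n => // n IHn in u i j v *.
rewrite ltnS => uv; have lower u' i' j' v' :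
    (size u' + size v').+1 = (size u + size v)%N -> defect u' i' j' v' = 0.
  by move=> sz; apply: IHn; rewrite sz.
have [ij|ijN] := boolP (descent i j); first exact: defect_descent.
have [ji|jiN] := boolP (descent j i).
  by rewrite defect_antisym defect_descent ?mulr0 ?oppr0.
have ij : i = j.
  move: ijN jiN; rewrite /is_descent !negb_or !negbK => /andP[ij _] /andP[ji _].
  by apply: (basis_anti bP); rewrite ij ji.
rewrite -ij in ijN *; apply: defect_even; move: ijN.
by rewrite /is_descent eqxx negb_or => /andP[].
Qed.
End NormalForm.

(** * Linear maps out of the enveloping algebra *)

Section EnvelopingInduction.
Variables (K : fieldType) (G : groupType) (eps : G -> G -> K).
Variable L : colorLieAlgebra eps.
Local Notation comp := (@color_comp K G eps L).

Lemma env_alg_ind (P : env_alg L -> Prop) :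
  P 1 -> (forall a u v, P u -> P v -> P (a *: u + v)) ->
  (forall g x u, x \in comp g -> P u -> P (env_in x * u)) -> forall u, P u.
Proof.
move=> P1 Plin Pmul.
have P0 : P 0 by have := Plin (-1) 1 1 P1 P1; rewrite scaleN1r addNr.
have PD u v : P u -> P v -> P (u + v).
  by move=> Pu Pv; rewrite -[u]scale1r; apply: Plin.
have Pin x u : P u -> P (env_in x * u).
  move=> Pu; have [/(_ x) [s [f [_ fg ->]]] _] := color_grading L.
  rewrite raddf_sum mulr_suml; elim/big_ind: _ => // g _.
  exact: Pmul (fg g) Pu.
move=> u; have [t ->] := @algquot_pi_surj _ _ _ (env_proper L) u.
have [p ->] := @algquot_pi_surj _ _ _ (tensor_proper L) t.
rewrite (freealg_span p) !raddf_sum /=; elim/big_ind: _ => // m _.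
rewrite !linearZ /= -[_ *: _]addr0; apply: Plin => //.
rewrite !rmorph_prod; elim: (m : seq L) => [|x s IHs]; first by rewrite big_nil.
by rewrite big_cons; apply: Pin.
Qed.
End EnvelopingInduction.

Lemma algquot_linear_lift (K : comPzRingType) (A : algType K) (S : set A)
    (Sproper : 1 \notin ideal_gen S) (M : lmodType K) (f : {linear A -> M}) :
  (forall x, x \in ideal_gen S -> f x = 0) ->
  exists F : {linear algquot_of Sproper -> M},
    forall x, F (algquot_pi Sproper x) = f x.
Proof.
move=> fS; pose F (q : algquot_of Sproper) : M := f (modquot_repr q).
have Fpi x : F (algquot_pi Sproper x) = f x.
  apply/eqP; rewrite -subr_eq0 -raddfB /=; apply/eqP/fS.
  by apply/algquot_pi_eq; rewrite algquot_reprK.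
have F_lin : linear F.
  move=> a p q; have [x ->] := algquot_pi_surj p.
  by have [y ->] := algquot_pi_surj q; rewrite -linearP !Fpi linearP.
pose FL : {linear algquot_of Sproper -> M} := HB.pack F
  (GRing.isLinear.Build K (algquot_of Sproper) M *:%R F F_lin).
by exists FL.
Qed.

Lemma linear_sandwich (K : comPzRingType) (A : algType K) (M : lmodType K)
    (f : {linear A -> M}) p q a x y :
  f (p * (a *: x + y) * q) = a *: f (p * x * q) + f (p * y * q).
Proof. by rewrite mulrDr mulrDl -scalerAr -scalerAl linearP. Qed.

(** * The Poincare-Birkhoff-Witt theorem *)

Section PBW.
Variables (K : fieldType) (G : groupType) (eps : G -> G -> K).
Variable L : colorLieAlgebra eps.
Local Notation comp := (@color_comp K G eps L).
Local Notation br := (@color_br K G eps L).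
Hypothesis charK0 : [pchar K] =i pred0.
Hypothesis eps_bichar : antisym_bicharacter eps.
Variables (I : choiceType) (le : rel I) (d : I -> G) (b : I -> L).
Hypothesis bP : homogeneous_basis le d b.
Implicit Types (i j k : I) (u v w : seq I) (x y : L).
Local Notation standard := (is_standard le (odd_index eps d)).

Definition monomial w : env_alg L := \prod_(i <- w) env_in (b i).
Definition word_degree w : G := (\prod_(i <- w) d i)%g.

Definition free_word w : freealg K I := << FMonom w >>.

Lemma free_wordM u v : free_word u * free_word v = free_word (u ++ v).
Proof.
rewrite /free_word malgM_def fgmulUU mulr1.
by congr mkmalgU; apply: fmmulE.
Qed.

(** Of the free algebra on the basis, only the multiplicative family of its
words matters for the construction of functionals. *)
Section Model.
Variables (phi : seq I -> K) (B : algType K) (word : seq I -> B).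
Variables (iota : {linear L -> B}) (lam : {linear B -> K^o}).
Local Notation nf := (normal_form bP phi).
Hypothesis wordM : forall u v, word u * word v = word (u ++ v).
Hypothesis word0 : word [::] = 1.
Hypothesis word_ind : forall P : B -> Prop, P 0 ->
  (forall a p q, P p -> P q -> P (a *: p + q)) ->
  (forall w, P (word w)) -> forall p, P p.
Hypothesis iota_word : forall i, iota (b i) = word [:: i].
Hypothesis lam_word : forall w, lam (word w) = nf w.

Lemma lam_slot u v x : lam (word u * iota x * word v) = slot bP nf u v x.
Proof.
move: x; apply: (basis_ind bP) => [|a x y xE yE|i].
- by rewrite raddf0 mulr0 mul0r raddf0 slot0.
- by rewrite linearP linear_sandwich xE yE slotP.
- by rewrite iota_word !wordM lam_word -catA slotE.
Qed.

Definition env_rel_image g h x y : B :=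
  iota x * iota y - eps g h *: (iota y * iota x) - iota (br x y).
Local Notation R := env_rel_image.

Lemma env_rel_image_linl g h a x x' y :
  R g h (a *: x + x') y = a *: R g h x y + R g h x' y.
Proof.
rewrite /R color_br_linearl !(linearP iota) mulrDl mulrDr -scalerAl -scalerAr.
rewrite [eps g h *: _]scalerDr scalerA mulrC -scalerA !scalerBr !opprD.
by rewrite [RHS]addrACA [X in _ = X + _]addrACA.
Qed.

Lemma env_rel_image_linr g h a x y y' :
  R g h x (a *: y + y') = a *: R g h x y + R g h x y'.
Proof.
rewrite /R color_br_linearr !(linearP iota) mulrDl mulrDr -scalerAl -scalerAr.
rewrite [eps g h *: _]scalerDr scalerA mulrC -scalerA !scalerBr !opprD.
by rewrite [RHS]addrACA [X in _ = X + _]addrACA.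
Qed.

(** By linearity in all four arguments, the vanishing of the defect on words is
the vanishing of the functional on the ideal of relations. *)
Lemma lam_env_rel g h x y p q : x \in comp g -> y \in comp h ->
  lam (p * R g h x y * q) = 0.
Proof.
have R0l y' : R g h 0 y' = 0.
  apply: (@linear_at0 K L B (R g h ^~ y')) => a u v.
  exact: env_rel_image_linl.
have R0r x' : R g h x' 0 = 0.
  apply: (@linear_at0 K L B (R g h x')) => a u v.
  exact: env_rel_image_linr.
move=> xg yh; move: p; apply: word_ind => [|a p p' pE p'E|u].
- by rewrite !mul0r raddf0.
- by rewrite !mulrDl -!scalerAl linearP pE p'E scaler0 addr0.
move: q; apply: word_ind => [|a q q' qE q'E|v].
- by rewrite mulr0 raddf0.
- by rewrite mulrDr -scalerAr linearP qE q'E scaler0 addr0.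
move: x xg; apply: (basis_comp_ind bP) => [|a x x' xE x'E|i di].
- by rewrite R0l mulr0 mul0r raddf0.
- by rewrite env_rel_image_linl linear_sandwich xE x'E scaler0 addr0.
move: y yh; apply: (basis_comp_ind bP) => [|a y y' yE y'E|j dj].
- by rewrite R0r mulr0 mul0r raddf0.
- by rewrite env_rel_image_linr linear_sandwich yE y'E scaler0 addr0.
rewrite /R !mulrBr !mulrBl -scalerAr -scalerAl !linearB /= linearZ /= lam_slot.
rewrite !iota_word !mulrA !wordM !lam_word -!catA /= -di -dj.
exact: (defect_eq0 charK0 eps_bichar).
Qed.

Lemma model_functional : exists f : {linear env_alg L -> K^o},
  forall w, f (monomial w) = nf w.
Proof.
have [F FE] := tensor_alg_lift iota.
pose T := tensor_alg L.
pose FL : {linear T -> K^o} := lam \o F.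
have FLE t : FL t = lam (F t) by [].
have kill s : s \in ideal_gen (env_rel (L := L)) -> lam (F s) = 0.
  move=> /asboolP; elim=> [|s1 s2 _ E1 _ E2|s1 r s2].
  - by rewrite !raddf0.
  - by rewrite !raddfD /= E1 E2 addr0.
  case=> g [h [x [y [xg yh ->]]]]; rewrite !rmorphM !rmorphB /=.
  by rewrite linearZ /= !rmorphM /= !FE lam_env_rel.
have [f fE] := @algquot_linear_lift _ _ _ (env_proper L) _ FL kill.
exists f => w; rewrite /monomial.
have -> : \prod_(i <- w) env_in (b i) = env_pi (\prod_(i <- w) tensor_in (b i)).
  by rewrite rmorph_prod.
rewrite fE FLE rmorph_prod -lam_word; congr (lam _).
elim: w => [|i w IHw]; first by rewrite big_nil.
by rewrite big_cons IHw /= FE iota_word wordM.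
Qed.
End Model.

Lemma functional_exists (phi : seq I -> K) :
  exists f : {linear env_alg L -> K^o},
    forall w, f (monomial w) = normal_form bP phi w.
Proof.
have [iota iotaE] := basis_extend bP (fun i => letter K i).
pose lam : {linear freealg K I -> K^o} :=
  lin_ext (fun m : {fmonom I} => normal_form bP phi m : K^o).
apply: (@model_functional phi (freealg K I) free_word iota lam).
- exact: free_wordM.
- by rewrite /free_word -fmoneE.
- by move=> P P0 Plin Pw p; apply: malg_lin_ind => // -[w]; apply: Pw.
- by move=> i; rewrite iotaE /letter fmuE.
- by move=> w; rewrite /lam /= lin_extU.
Qed.

Lemma monomial_cons i w : monomial (i :: w) = env_in (b i) * monomial w.
Proof. by rewrite /monomial big_cons. Qed.

Lemma monomial_cat u v : monomial (u ++ v) = monomial u * monomial v.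
Proof. by rewrite /monomial big_cat. Qed.

Lemma word_degree_cons i w : word_degree (i :: w) = (d i * word_degree w)%g.
Proof. by rewrite /word_degree big_cons. Qed.

Lemma word_degree_cat u v :
  word_degree (u ++ v) = (word_degree u * word_degree v)%g.
Proof. by rewrite /word_degree big_cat. Qed.

Definition pbw_monomials g : set (env_alg L) :=
  fun z => exists w, [/\ standard w, word_degree w = g & z = monomial w].

Hypothesis G_abelian : forall g h : G, (g * h)%g = (h * g)%g.

(** Straightening decreases the length of the word, or keeps it and decreases
the number of inversions.  Degrees are preserved because [G] is abelian. *)
Lemma monomial_straighten w :
  monomial w \in lspan (pbw_monomials (word_degree w)).
Proof.
have [n] := ubnP (size w); elim: n => // n IHn in w *; rewrite ltnS => wn.
have [c] := ubnP (inversions le w); elim: c => // c IHc in w wn *.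
rewrite ltnS => wc; case E: (first_descent le (odd_index eps d) w) =>
    [[[[u i] j] v]|]; last first.
  by apply: lspan_sub; exists w; split=> //; apply: first_descent_none E.
have [wE ij] := first_descent_some E; rewrite wE in wn wc *.
have sz : (size (u ++ i :: j :: v) = (size u + size v).+2)%N.
  by rewrite size_cat /= !addnS.
have lower x : x \in comp (d i * d j)%g ->
    monomial u * env_in x * monomial v \in
      lspan (pbw_monomials (word_degree (u ++ i :: j :: v))).
  move: x; apply: (basis_comp_ind bP) => [|a y z yE zE|k dk].
  - by rewrite raddf0 mulr0 mul0r rpred0.
  - by rewrite linearP mulrDr mulrDl -scalerAr -scalerAl rpredD ?rpredZ.
  rewrite -mulrA -monomial_cons -monomial_cat.
  have -> : word_degree (u ++ i :: j :: v) = word_degree (u ++ k :: v).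
    by rewrite !word_degree_cat !word_degree_cons dk -!mulgA.
  by apply: IHn; move: wn; rewrite sz size_cat /= addnS; lia.
have brij := color_br_comp (basis_comp bP i) (basis_comp bP j).
have := env_in_br (basis_comp bP i) (basis_comp bP j).
have -> : monomial (u ++ i :: j :: v) =
    monomial u * (env_in (b i) * env_in (b j)) * monomial v.
  by rewrite monomial_cat !monomial_cons !mulrA.
have [ijE|iNj] := eqVneq i j.
  rewrite -ijE in ij lower brij *.
  have qii : eps (d i) (d i) = -1.
    apply: (odd_indexE eps_bichar); move: ij.
    by rewrite /is_descent (le_refl (basis_total bP)) eqxx.
  rewrite qii scaleN1r opprK -mulr2n -scaler_nat => sq.
  have -> : env_in (b i) * env_in (b i) =
      2%:R^-1 *: env_in (br (b i) (b i)) :> env_alg L.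
    by rewrite -sq scalerA mulVf ?scale1r ?natr_neq0.
  by rewrite -scalerAr -scalerAl rpredZ // lower.
have ijN : ~~ le i j by move: ij; rewrite /is_descent (negbTE iNj) orbF.
move/eqP; rewrite subr_eq => /eqP ->.
rewrite mulrDr mulrDl -scalerAr -scalerAl.
apply: rpredD; first exact: lower.
apply: rpredZ.
have -> : monomial u * (env_in (b j) * env_in (b i)) * monomial v =
    monomial (u ++ j :: i :: v) by rewrite monomial_cat !monomial_cons !mulrA.
have -> : word_degree (u ++ i :: j :: v) = word_degree (u ++ j :: i :: v).
  rewrite !word_degree_cat !word_degree_cons.
  by congr (_ * _)%g; rewrite !mulgA (G_abelian (d i)).
apply: IHc; first by move: wn; rewrite !size_cat.
by move: wc; rewrite (inversions_swap (basis_total bP)).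
Qed.

Lemma env_in_mul_pbw g h x (u : env_alg L) :
  x \in comp g -> u \in lspan (pbw_monomials h) ->
  env_in x * u \in lspan (pbw_monomials (g * h)%g).
Proof.
move=> xg; move: u; apply: lspan_ind => [|a v v' vE v'E|_ [w [_ <- ->]]].
- by rewrite mulr0 rpred0.
- by rewrite mulrDr -scalerAr rpredD ?rpredZ.
move: x xg; apply: (basis_comp_ind bP) => [|a x y xE yE|i <-].
- by rewrite raddf0 mul0r rpred0.
- by rewrite linearP mulrDl -scalerAl rpredD ?rpredZ.
by rewrite -monomial_cons -word_degree_cons monomial_straighten.
Qed.

Lemma one_pbw : 1 \in lspan (pbw_monomials 1%g).
Proof.
by apply: lspan_sub; exists [::]; rewrite /monomial /word_degree !big_nil.
Qed.

Theorem pbw_span_graded g (u : env_alg L) : u \in env_comp L g ->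
  u \in lspan (pbw_monomials g).
Proof.
move=> /asboolP[t tg ->]; move: t tg.
apply: lspan_ind => [|a t t' tE t'E|_ [s [s_comp <- ->]]].
- by rewrite raddf0 rpred0.
- by rewrite linearP rpredD ?rpredZ.
rewrite rmorph_prod /=; elim: s s_comp => [|p s IHs] s_comp.
  by rewrite !big_nil one_pbw.
rewrite !big_cons; apply: env_in_mul_pbw; first by rewrite s_comp ?mem_head.
by apply: IHs => p' p's; rewrite s_comp // inE p's orbT.
Qed.

Theorem pbw_span (u : env_alg L) :
  u \in lspan (fun z => exists2 w, standard w & z = monomial w).
Proof.
have sub g (v : env_alg L) : v \in lspan (pbw_monomials g) ->
    v \in lspan (fun z => exists2 w, standard w & z = monomial w).
  by apply: lspan_min => _ [w [ws _ ->]]; apply: lspan_sub; exists w.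
move: u; apply: env_alg_ind => [|a u v uE vE|g x u xg].
- exact: sub one_pbw.
- by rewrite rpredD ?rpredZ.
move: u; apply: lspan_ind => [|a v v' vE v'E|_ [w ws ->]].
- by rewrite mulr0 rpred0.
- by rewrite mulrDr -scalerAr rpredD ?rpredZ.
apply: (sub (g * word_degree w)%g); apply: env_in_mul_pbw => //.
by apply: lspan_sub; exists w.
Qed.

(** Scalar functionals separate the standard monomials: with the indicator
function of a standard word as prescribed values, the normal form functional
reads off the coefficient of that word. *)
Theorem pbw_extend (M : lmodType K) (phi : seq I -> M) :
  exists f : {linear env_alg L -> M},
    forall w, standard w -> f (monomial w) = phi w.
Proof.
pose T : choiceType := {w : seq I | standard w}.
have [u|p p0|f fE] := @basis_universal K (env_alg L) T
    (fun t => monomial (val t)) _ _ M (fun t => phi (val t)).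
- move: u (pbw_span u); apply: lspan_min => _ [w ws ->].
  by apply: lspan_sub; exists (Sub w ws).
- apply/malgP => t; rewrite mcoeff0.
  have [f fE] := functional_exists (fun w => (w == val t)%:R).
  suff fp p' : f (lin_ext (fun s : T => monomial (val s)) p') = p'@_t.
    by rewrite -fp p0 raddf0.
  move: p'; apply: malg_lin_ind => [|a p1 p2 E1 E2|k].
  - by rewrite mcoeff0 !raddf0.
  - by rewrite !linearP /= E1 E2 mcoeffD mcoeffZ.
  rewrite lin_extU fE normal_form_standard ?(valP k) // mcoeffU.
  by rewrite (inj_eq val_inj).
by exists f => w ws; rewrite -(fE (Sub w ws)).
Qed.
End PBW.

(** * The central extension attached to a cocycle *)

Section CocycleAtZero.
Variables (K : fieldType) (G : groupType) (eps : G -> G -> K).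
Variables (L : colorLieAlgebra eps) (w : L -> L -> K).
Hypothesis wZ : is_cocycle2 w.

Lemma cocycle2_0l y : w 0 y = 0.
Proof. exact: (@linear_at0 K L K^o _ (cocycle2_linearl wZ y)). Qed.

Lemma cocycle2_0r x : w x 0 = 0.
Proof. exact: (@linear_at0 K L K^o _ (cocycle2_linearr wZ x)). Qed.
End CocycleAtZero.

Section CentralExtension.
Variables (K : fieldType) (G : groupType) (eps : G -> G -> K).
Variable L : colorLieAlgebra eps.
Local Notation comp := (@color_comp K G eps L).
Local Notation br := (@color_br K G eps L).
Hypothesis eps_bichar : antisym_bicharacter eps.
Variable w : L -> L -> K.
Hypothesis wZ : is_cocycle2 w.

Local Notation car := (L * K^o)%type.
Implicit Types (p r : car) (x y z : L).

Definition cext_comp_pred (g : G) : {pred car} :=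
  fun p => (p.1 \in comp g) && ((g == 1%g) || (p.2 == 0)).

Lemma cext_comp_predE g p :
  (p \in cext_comp_pred g) = (p.1 \in comp g) && ((g == 1%g) || (p.2 == 0)).
Proof. by []. Qed.

Lemma cext_comp_closed g : submod_closed (cext_comp_pred g).
Proof.
split=> [|a p r]; rewrite !cext_comp_predE /= ?rpred0 ?eqxx ?orbT //.
move=> /andP[pg pe] /andP[rg re]; rewrite rpredD ?rpredZ //=.
by case: (g == 1%g) pe re => //= /eqP -> /eqP ->; rewrite scaler0 addr0.
Qed.
HB.instance Definition _ g := GRing.isSubmodClosed.Build K car
  (cext_comp_pred g) (GRing.submod_closed_semi (cext_comp_closed g)).

Definition cext_comp (g : G) : submodClosed car := cext_comp_pred g.

Lemma cext_compE g p :
  (p \in cext_comp g) = (p.1 \in comp g) && ((g == 1%g) || (p.2 == 0)).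
Proof. by []. Qed.

Definition cext_br p r : car := (br p.1 r.1, w p.1 r.1).

Lemma cext_comp_inl g x : x \in comp g -> ((x, 0) : car) \in cext_comp g.
Proof. by rewrite cext_compE /= eqxx orbT andbT. Qed.

Lemma cext_comp_center : ((0, 1) : car) \in cext_comp 1%g.
Proof. by rewrite cext_compE /= rpred0 eqxx. Qed.

Lemma cext_grading : is_grading cext_comp.
Proof.
have sum_pair (r : seq G) (F : G -> L) (H : G -> K^o) :
    \sum_(g <- r) ((F g, H g) : car) = (\sum_(g <- r) F g, \sum_(g <- r) H g).
  by elim: r => [|g r IHr]; rewrite ?big_nil // !big_cons IHr.
have [dec ind] := color_grading L; split=> [[x a]|s f us fg].
  have [s [f [us fg xE]]] := dec x.
  pose f0 g := if g \in s then f g else 0.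
  pose s1 := undup (1%g :: s).
  exists s1, (fun g => (f0 g, if g == 1%g then a else 0) : car).
  split; first exact: undup_uniq.
    move=> g; rewrite cext_compE /= /f0; case: ifP => _; rewrite ?rpred0 ?fg /=;
    by case: (g == 1%g); rewrite ?eqxx.
  rewrite sum_pair -!big_mkcond /=; congr (_, _).
    rewrite xE -[RHS]big_filter; apply: perm_big; apply: uniq_perm => //.
      by rewrite filter_uniq ?undup_uniq.
    move=> g; rewrite mem_filter mem_undup inE.
    by case: (g \in s); rewrite ?orbT.
  rewrite -big_filter filter_pred1_uniq ?undup_uniq ?mem_undup ?mem_head //.
  by rewrite big_seq1.
rewrite (eq_bigr (fun g => ((f g).1, (f g).2))) => [|g _]; last by case: (f g).
rewrite sum_pair => -[sum1 sum2] g gs.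
have fg' h : ((f h).1 \in comp h) && ((h == 1%g) || ((f h).2 == 0)).
  by rewrite -cext_compE.
have f1 : (f g).1 = 0.
  by apply: (ind s (fun h => (f h).1)) => // h; have /andP[] := fg' h.
rewrite [f g]surjective_pairing f1; congr (_, _).
have [g1|gN1] := eqVneq g 1%g; last first.
  by have /andP[_] := fg' g; rewrite (negbTE gN1) => /eqP.
rewrite (bigD1_seq g) //= big1 ?addr0 // in sum2 => h hNg.
by have /andP[_] := fg' h; rewrite -g1 (negbTE hNg) => /eqP.
Qed.

Lemma cext_br_linearl r : linear (cext_br^~ r).
Proof.
by move=> a p p'; rewrite /cext_br /= color_br_linearl (cocycle2_linearl wZ).
Qed.

Lemma cext_br_linearr p : linear (cext_br p).
Proof.
by move=> a r r'; rewrite /cext_br /= color_br_linearr (cocycle2_linearr wZ).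
Qed.

Lemma cext_br_comp g h p r : p \in cext_comp g -> r \in cext_comp h ->
  cext_br p r \in cext_comp (g * h)%g.
Proof.
rewrite !cext_compE.
move=> /andP[pg _] /andP[rh _]; rewrite color_br_comp //=.
by case: eqP => //= gh; rewrite (cocycle2_comp wZ pg rh gh) eqxx.
Qed.

Lemma cext_br_antisym g h p r : p \in cext_comp g -> r \in cext_comp h ->
  cext_br p r = - (eps g h *: cext_br r p).
Proof.
move=> /andP[pg _] /andP[rh _].
by rewrite /cext_br (color_br_antisym pg rh) (cocycle2_antisym wZ pg rh).
Qed.

(** The component along the centre is the cocycle condition multiplied by
[- eps k g]. *)
Lemma cext_br_jacobi g h k p q r :
    p \in cext_comp g -> q \in cext_comp h -> r \in cext_comp k ->
  eps k g *: cext_br p (cext_br q r) + eps g h *: cext_br q (cext_br r p)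
    + eps h k *: cext_br r (cext_br p q) = 0.
Proof.
move=> /andP[pg _] /andP[qh _] /andP[rk _]; rewrite /cext_br /=.
apply: (congr2 (fun a b => (a, b) : car)); first exact: color_br_jacobi.
rewrite /GRing.scale /=; move: p.1 q.1 r.1 pg qh rk => x y z xg yh zk.
have wN c u v : w (- (c *: u)) v = - (c * w u v).
  have := cocycle2_linearl wZ v (- c) u 0; rewrite addr0 scaleNr => ->.
  by rewrite (cocycle2_0l wZ) addr0 mulNr.
rewrite (cocycle2_antisym wZ xg (color_br_comp yh zk)).
rewrite (cocycle2_antisym wZ yh (color_br_comp zk xg)).
rewrite (cocycle2_antisym wZ zk (color_br_comp xg yh)).
rewrite (color_br_antisym zk xg) wN !(bicharMr eps_bichar).
have gk := bichar_antisym eps_bichar g k.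
have gh := bichar_antisym eps_bichar g h.
have hk := bichar_antisym eps_bichar h k.
transitivity (- eps k g * (w (br x y) z - eps h k * w (br x z) y
    + eps g h * eps g k * w (br y z) x)
  + eps k g * (1 - eps h k * eps k h) * w (br x y) z
  - eps k g * (1 - eps g h * eps h g) * eps h k * w (br x z) y).
  by rewrite /GRing.scale /=; ring.
rewrite (cocycle2_jacobi wZ xg yh zk) hk gh subrr.
by rewrite !(mulr0, mul0r, addr0, subr0).
Qed.

Definition central_extension : colorLieAlgebra eps := ColorLieAlgebra
  cext_grading cext_br_linearl cext_br_linearr cext_br_comp cext_br_antisym
  cext_br_jacobi.

Section Basis.
Variables (I : choiceType) (le : rel I) (d : I -> G) (b : I -> L).
Hypothesis bP : homogeneous_basis le d b.

(** The central vector, of index [None], is the least element, so that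
multiplying a standard monomial by it on the left gives a standard monomial. *)
Definition cext_le : rel (option I) := fun i j =>
  match i, j with
  | None, _ => true
  | Some _, None => false
  | Some i, Some j => le i j
  end.

Definition cext_deg (i : option I) : G := if i is Some i then d i else 1%g.

Definition cext_basis (i : option I) : central_extension :=
  if i is Some i then (b i, 0) else (0, 1).

Lemma cext_basisP : homogeneous_basis cext_le cext_deg cext_basis.
Proof.
split=> [[i|] [j|] //=|[i|] [j|] //= ij|[i|] [j|] [k|] //=|[i|]|g [x a]|M phi].
- exact: (basis_total bP).
- by rewrite (basis_anti bP ij).
- exact: (basis_trans bP).
- exact: cext_comp_inl (basis_comp bP i).
- exact: cext_comp_center.
- rewrite cext_compE /= => /andP[xg ga].
  have -> : ((x, a) : central_extension) = a *: (0, 1) + (x, 0).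
    by congr (_, _); rewrite /= ?scaler0 ?add0r // addr0 /GRing.scale /= mulr1.
  apply: rpredD.
    case/orP: ga => [/eqP ->|/eqP ->]; last by rewrite scale0r rpred0.
    by apply: rpredZ; apply: lspan_sub; exists None.
  move: x xg; apply: (basis_comp_ind bP) => [|c x y xE yE|i di].
  + exact: rpred0.
  + have -> : ((c *: x + y, 0) : central_extension) = c *: (x, 0) + (y, 0).
      by congr (_, _); rewrite /= scaler0 addr0.
    by rewrite rpredD ?rpredZ.
  + by apply: lspan_sub; exists (Some i).
have [f fE] := basis_extend bP (fun i => phi (Some i)).
have F_lin : linear (fun p : central_extension => f p.1 + p.2 *: phi None).
  move=> a p r; rewrite linearP /= scalerDl scalerDr scalerA.
  by rewrite addrACA.
pose F : {linear central_extension -> M} := HB.pack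
  (fun p : central_extension => f p.1 + p.2 *: phi None)
  (GRing.isLinear.Build K central_extension M *:%R _ F_lin).
exists F => -[i|]; rewrite /F /=; first by rewrite fE scale0r addr0.
by rewrite raddf0 add0r scale1r.
Qed.
End Basis.
End CentralExtension.

(** * Deformations at first order *)

Section Deformations.
Variables (K : fieldType) (G : groupType) (A : algType K).
Variable comp : G -> submodClosed A.

Lemma series_mul_local (m : nat -> A -> A -> A) (a a' c c' : series A) n :
  (forall i, (i <= n)%N -> a i = a' i) ->
  (forall i, (i <= n)%N -> c i = c' i) ->
  series_mul m a c n = series_mul m a' c' n.
Proof.
move=> aE cE; apply: eq_bigr => i _; apply: eq_bigr => j _.
have i_n := ltn_ord i; have j_n := ltn_ord j.
by rewrite aE ?cE //; lia.
Qed.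

(** The coefficient of [t] in the equation [f(x y) = m(f x, f y)] for the
constant series [x] and [y]. *)
Lemma trivial_deformation_order1 (m : nat -> A -> A -> A) :
  graded_deformation comp m -> trivial_deformation comp m ->
  exists2 f : A -> A, linear_degree_e comp f &
    forall x y, m 1%N x y = f (x * y) - f x * y - x * f y.
Proof.
move=> [m_bil m0 _] [f [f_inv [f0 f_lin _ f_invK fE]]].
exists (f 1%N); first exact: f_lin.
move=> x y; pose const z : series A := fun n => if n is 0 then z else 0.
have := congr1 (fun s => series_map f s 1%N) (fE (const x) (const y)).
rewrite f_invK /series_mul /series_map /=.
rewrite !big_ord_recl !big_ord0 /= /bump /= !subn0 !subnn f0 m0 /=.
rewrite mulr0 mul0r !addr0 => ->.
by rewrite !addrK.
Qed.

(** A Hochschild coboundary [D] of [f] involves, apart from [f(xy)], only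
multiples of [x] and of [y], which the augmentation kills. *)
Lemma coboundary_commutator (D : A -> A -> A) (f : A -> A)
    (aug : {lrmorphism A -> K^o}) (e : K) x y :
  linear f -> (forall x y, D x y = f (x * y) - f x * y - x * f y) ->
  aug x = 0 -> aug y = 0 ->
  aug (D x y - e *: D y x) = aug (f (x * y - e *: (y * x))).
Proof.
move=> f_lin DE x0 y0.
have augD u v : aug u = 0 -> aug v = 0 -> aug (D u v) = aug (f (u * v)).
  move=> u0 v0; rewrite DE !rmorphB /= !rmorphM /= u0 v0 mulr0 mul0r.
  by rewrite !subr0.
have augZ u : aug (e *: u) = e * aug u by exact: linearZ.
have -> : f (x * y - e *: (y * x)) = f (x * y) - e *: f (y * x).
  by rewrite addrC -scaleNr f_lin addrC scaleNr.
by rewrite !rmorphB /= !augZ !augD.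
Qed.

End Deformations.

(** * The star product of a torsion-free family *)

(** In this section [E] is an algebra over K[t] with fibre [A] at [t = 0].  The
identity [delta (t * a) = a] says that [t] is not a zero divisor, and [decomp]
that the kernel of [pi] is generated by [t], with quotient map [delta]. *)

Section TorsionFreeFamily.
Variables (K : fieldType) (G : groupType) (A E : algType K).
Variables (compA : G -> submodClosed A) (compE : G -> submodClosed E).
Variables (pi : {lrmorphism E -> A}) (s : {linear A -> E}).
Variables (t : E) (delta : {linear E -> E}).
Hypotheses (pi_t : pi t = 0) (t_central : forall a, a * t = t * a).
Hypothesis delta_t : forall a, delta (t * a) = a.
Hypothesis pi_s : forall x, pi (s x) = x.
Hypothesis decomp : forall a, a = s (pi a) + t * delta a.
Hypothesis compE_mul : forall g h a c,
  a \in compE g -> c \in compE h -> a * c \in compE (g * h)%g.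
Hypothesis pi_comp : forall g a, a \in compE g -> pi a \in compA g.
Hypothesis s_comp : forall g x, x \in compA g -> s x \in compE g.
Hypothesis delta_comp : forall g a, a \in compE g -> delta a \in compE g.
Implicit Types (a c : E) (x y : A).

(** The coefficients of the expansion of [a] in powers of [t]. *)
Definition t_coef a : series A := fun n => pi (iter n delta a).
Definition star n x y : A := t_coef (s x * s y) n.

Lemma t_coef_linear n : linear (t_coef^~ n).
Proof.
move=> k a c; rewrite /t_coef -linearP; congr (pi _).
by elim: n => //= n ->; rewrite linearP.
Qed.

Lemma t_coefD n a c : t_coef (a + c) n = t_coef a n + t_coef c n.
Proof. by have := t_coef_linear n 1 a c; rewrite !scale1r. Qed.

Lemma t_coef0 n : t_coef 0 n = 0.
Proof. exact: linear_at0 (t_coef_linear n). Qed.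

Lemma t_coef_sum n (r : seq nat) (F : nat -> E) :
  t_coef (\sum_(i <- r) F i) n = \sum_(i <- r) t_coef (F i) n.
Proof. exact: (big_morph (t_coef^~ n) (t_coefD n) (t_coef0 n)). Qed.

Lemma delta_s x : delta (s x) = 0.
Proof.
have := decomp (s x); rewrite pi_s => /eqP; rewrite addrC -subr_eq subrr.
by move=> /eqP ts0; rewrite -[LHS]delta_t -ts0 raddf0.
Qed.

Lemma t_coef_s x n : t_coef (s x) n = if n is 0 then x else 0.
Proof.
case: n => [|n]; first exact: pi_s.
rewrite /t_coef iterSr delta_s (_ : iter n delta 0 = 0) ?raddf0 //.
by elim: n => //= n ->; rewrite raddf0.
Qed.

Lemma t_coef_t k a n :
  t_coef (t ^+ k * a) n = if (k <= n)%N then t_coef a (n - k)%N else 0.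
Proof.
elim: k n => [|k IHk] [|n]; rewrite ?expr0 ?mul1r ?subn0 //.
  by rewrite exprS -mulrA /t_coef /= rmorphM /= pi_t mul0r.
by rewrite exprS -mulrA /t_coef iterSr delta_t -/(t_coef _ n) IHk ltnS subSS.
Qed.

Definition t_lift N (u : series A) : E := \sum_(0 <= i < N) t ^+ i * s (u i).

Lemma t_coef_lift N (u : series A) n : (n < N)%N -> t_coef (t_lift N u) n = u n.
Proof.
move=> nN; rewrite t_coef_sum (bigD1_seq n) ?mem_index_iota ?iota_uniq //=.
rewrite t_coef_t leqnn subnn t_coef_s big1 ?addr0 // => i iNn.
rewrite t_coef_t t_coef_s; case: leqP => // i_n.
by case ni: (n - i)%N => //; case/eqP: iNn; lia.
Qed.

Lemma t_expansion N a : a = t_lift N (t_coef a) + t ^+ N * iter N delta a.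
Proof.
elim: N => [|N IHN]; first by rewrite /t_lift big_geq // expr0 mul1r add0r.
rewrite /t_lift big_nat_recr //= -/(t_lift N _) [LHS]IHN -addrA; congr (_ + _).
by rewrite [X in _ * X = _]decomp mulrDr exprSr mulrA.
Qed.

(** Taking coefficients is multiplicative from [E] to the series with the star
product: multiply two expansions, the remainders contributing multiples of
[t ^+ n.+1] only. *)
Lemma t_coefM a c n :
  t_coef (a * c) n = series_mul star (t_coef a) (t_coef c) n.
Proof.
have tC k e : e * t ^+ k = t ^+ k * e.
  elim: k => [|k IHk]; rewrite ?mulr1 ?mul1r // exprS mulrA t_central -mulrA.
  by rewrite IHk mulrA.
rewrite {1}(t_expansion n.+1 a) {1}(t_expansion n.+1 c).
set a' := iter _ _ a; set c' := iter _ _ c.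
rewrite mulrDl mulrDr [X in _ + X + _]mulrA tC -mulrA -[X in _ + X]mulrA.
rewrite -addrA -mulrDr.
rewrite t_coefD t_coef_t ltnn addr0 /t_lift mulr_suml t_coef_sum /series_mul.
rewrite -(big_mkord xpredT (fun i => \sum_(j < (n - i).+1)
  star (n - i - j)%N (t_coef a i) (t_coef c j))).
apply: eq_big_nat => i /andP[_ i_n].
rewrite mulr_sumr t_coef_sum (big_ord_widen n.+1
  (fun j => star (n - i - j)%N (t_coef a i) (t_coef c j))); last by lia.
rewrite big_mkord [RHS]big_mkcond; apply: eq_bigr => j _.
rewrite -mulrA [s _ * _]mulrA tC -[X in _ * X]mulrA mulrA -exprD.
rewrite t_coef_t subnDA.
by rewrite /star ltnS leq_subRL ?ltnS.
Qed.

(** The first-order term of the star product sees the part of a commutator in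
[E] which lies along [t]. *)
Lemma star1_commutator (k e : K) x y u :
  s x * s y - e *: (s y * s x) = s u + k *: t ->
  star 1 x y - e *: star 1 y x = k%:A.
Proof.
move=> xy; have star1 x' y' : star 1 x' y' = pi (delta (s x' * s y')) by [].
rewrite !star1 -linearZ -raddfB /= -linearZ -raddfB /= xy linearD /= delta_s.
by rewrite add0r -[t]mulr1 !linearZ /= delta_t rmorph1.
Qed.

(** Up to order [n] every series is the series of coefficients of an element of
[E], so associativity is inherited from [E]. *)
Lemma star_assoc : associative (series_mul star).
Proof.
move=> x y z; apply/funext => n.
have liftE u i : (i <= n)%N -> u i = t_coef (t_lift n.+1 u) i.
  by move=> i_n; rewrite t_coef_lift.
have liftM u v i : (i <= n)%N ->
    series_mul star u v i = t_coef (t_lift n.+1 u * t_lift n.+1 v) i.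
  move=> i_n; rewrite t_coefM; apply: series_mul_local => j j_i;
    by apply: liftE; apply: leq_trans i_n.
rewrite (series_mul_local _ (liftE x) (liftM y z)).
rewrite (series_mul_local _ (liftM x y) (liftE z)).
by rewrite -!t_coefM mulrA.
Qed.

Theorem star_graded_deformation : graded_deformation compA star.
Proof.
split=> [n||]; last exact: star_assoc.
  split=> [y k x x'|x k y y'|g h x y xg yh].
  - by rewrite /star linearP mulrDl -scalerAl t_coef_linear.
  - by rewrite /star linearP mulrDr -scalerAr t_coef_linear.
  apply: pi_comp; elim: n => [|n IHn] /=; last exact: delta_comp.
  by apply: compE_mul; apply: s_comp.
apply/funext => x; apply/funext => y.
by rewrite /star /t_coef /= rmorphM /= !pi_s.
Qed.
End TorsionFreeFamily.

(** * Grading and augmentation of the enveloping algebra *)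

Section EnvelopingGrading.
Variables (K : fieldType) (G : groupType) (eps : G -> G -> K).
Variable L : colorLieAlgebra eps.
Local Notation comp := (@color_comp K G eps L).

Lemma env_in_comp g x : x \in comp g -> env_in x \in env_comp L g.
Proof.
move=> xg; apply/asboolP; exists (tensor_in x) => //.
by apply: lspan_sub; exists [:: (g, x)]; rewrite !big_seq1; split=> // p;
  rewrite inE => /eqP ->.
Qed.

Lemma env_comp_mul g h (u v : env_alg L) :
  u \in env_comp L g -> v \in env_comp L h -> u * v \in env_comp L (g * h)%g.
Proof.
move=> /asboolP[t tg ->] /asboolP[t' th ->]; apply/asboolP.
exists (t * t'); last by rewrite rmorphM.
move: t tg; apply: lspan_ind => [|a t1 t2 E1 E2|_ [s [s_comp <- ->]]].
- by rewrite mul0r rpred0.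
- by rewrite mulrDl -scalerAl rpredD ?rpredZ.
move: t' th; apply: lspan_ind => [|a t1 t2 E1 E2|_ [s' [s'_comp <- ->]]].
- by rewrite mulr0 rpred0.
- by rewrite mulrDr -scalerAr rpredD ?rpredZ.
apply: lspan_sub; exists (s ++ s'); rewrite !big_cat; split=> // p.
by rewrite mem_cat => /orP[/s_comp|/s'_comp].
Qed.

Lemma env_comp1 : 1 \in env_comp L 1%g.
Proof.
apply/asboolP; exists 1; last by rewrite rmorph1.
by apply: lspan_sub; exists [::]; rewrite !big_nil.
Qed.

Lemma augmentation_exists : exists aug : {lrmorphism env_alg L -> K^o},
  (forall x, aug (env_in x) = 0) /\
  (forall g u, u \in env_comp L g -> g <> 1%g -> aug u = 0).
Proof.
pose z : {linear L -> K^o} := \0.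
have [|aug augE] := env_alg_lift (f := z).
  by move=> g h x y _ _; rewrite /z /= mul0r scaler0 subr0.
exists aug; split=> [x|g u /asboolP[t tg ->] g1]; first by rewrite augE.
move: t tg; apply: lspan_ind => [|a t t' E E'|_ [s [_ sg ->]]].
- by rewrite !raddf0.
- by rewrite !linearP /= E E' scaler0 addr0.
case: s sg => [|p s] sg; first by case: g1; rewrite -sg big_nil.
by rewrite big_cons !rmorphM /= (augE p.2) mul0r.
Qed.

End EnvelopingGrading.

Lemma monomial_comp (K : fieldType) (G : groupType) (eps : G -> G -> K)
    (L : colorLieAlgebra eps) (I : choiceType) (le : rel I) (d : I -> G)
    (b : I -> L) :
  homogeneous_basis le d b ->
  forall w, monomial b w \in env_comp L (word_degree d w).
Proof.
move=> bP; elim=> [|i w IHw].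
  by rewrite /monomial /word_degree !big_nil env_comp1.
rewrite monomial_cons word_degree_cons; apply: env_comp_mul => //.
exact: env_in_comp (basis_comp bP i).
Qed.

(** * Splitting the enveloping algebra of a central extension *)

(** Maps between two algebras spanned by given monomials, those of the second
indexed by words over one more letter [None], which acts as multiplication by
[t].  All identities are checked on monomials. *)

Section MonomialSplitting.
Variables (K : fieldType) (G : groupType) (A B : algType K).
Variables (compA : G -> submodClosed A) (compB : G -> submodClosed B).
Variables (I : choiceType) (stdA : pred (seq I)) (stdB : pred (seq (option I))).
Variables (monoA : seq I -> A) (monoB : seq (option I) -> B).
Variables (degA : seq I -> G) (degB : seq (option I) -> G).
Variables (t : B) (pi : {lrmorphism B -> A}) (s : {linear A -> B}).
Variable delta : {linear B -> B}.
Hypothesis stdB_map : forall v, stdB (map Some v) = stdA v.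
Hypothesis stdB_None : forall v, stdB v -> stdB (None :: v).
Hypothesis stdB_case : forall v, stdB v ->
  (exists2 v', v = None :: v' & stdB v') \/
  (exists2 v', v = map Some v' & stdA v').
Hypothesis degB_map : forall v, degB (map Some v) = degA v.
Hypothesis degB_None : forall v, degB (None :: v) = degB v.
Hypothesis spanA : forall u,
  u \in lspan (fun y => exists2 v, stdA v & y = monoA v).
Hypothesis spanB : forall u,
  u \in lspan (fun y => exists2 v, stdB v & y = monoB v).
Hypothesis gspanA : forall g u, u \in compA g ->
  u \in lspan (fun y => exists v, [/\ stdA v, degA v = g & y = monoA v]).
Hypothesis gspanB : forall g u, u \in compB g ->
  u \in lspan (fun y => exists v, [/\ stdB v, degB v = g & y = monoB v]).
Hypothesis monoA_comp : forall v, monoA v \in compA (degA v).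
Hypothesis monoB_comp : forall v, monoB v \in compB (degB v).
Hypothesis monoB_None : forall v, monoB (None :: v) = t * monoB v.
Hypothesis pi_t : pi t = 0.
Hypothesis pi_mono : forall v, pi (monoB (map Some v)) = monoA v.
Hypothesis s_mono : forall v, stdA v -> s (monoA v) = monoB (map Some v).
Hypothesis delta_mono : forall v, stdB v ->
  delta (monoB v) = if v is None :: v' then monoB v' else 0.

Lemma split_delta_t a : delta (t * a) = a.
Proof.
move: a (spanB a); apply: lspan_ind => [|k u v uE vE|_ [v vs ->]].
- by rewrite mulr0 raddf0.
- by rewrite mulrDr -scalerAr linearP uE vE.
- by rewrite -monoB_None delta_mono ?stdB_None.
Qed.

Lemma split_pi_s u : pi (s u) = u.
Proof.
move: u (spanA u); apply: lspan_ind => [|k u v uE vE|_ [v vs ->]].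
- by rewrite !raddf0.
- by rewrite !linearP /= uE vE.
- by rewrite s_mono.
Qed.

Lemma split_decomp a : a = s (pi a) + t * delta a.
Proof.
move: a (spanB a); apply: lspan_ind => [|k u v uE vE|_ [v vs ->]].
- by rewrite !raddf0 mulr0 addr0.
- rewrite {1}uE {1}vE !linearP /= mulrDr -scalerAr scalerDr.
  by rewrite addrACA.
case: (stdB_case vs) => [[v' -> v's]|[v' -> v's]].
  rewrite delta_mono ?stdB_None // monoB_None rmorphM /= pi_t mul0r.
  by rewrite raddf0 add0r.
rewrite pi_mono s_mono // delta_mono ?stdB_map //.
by case: v' {v's} => [|i v'] /=; rewrite mulr0 addr0.
Qed.

Lemma split_pi_comp g a : a \in compB g -> pi a \in compA g.
Proof.
move=> /gspanB; move: a; apply: lspan_ind => [|k u v uE vE|_ [v [vs <- ->]]].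
- by rewrite raddf0 rpred0.
- by rewrite linearP rpredD ?rpredZ.
case: (stdB_case vs) => [[v' -> v's]|[v' -> v's]].
  by rewrite monoB_None rmorphM /= pi_t mul0r rpred0.
by rewrite pi_mono degB_map.
Qed.

Lemma split_s_comp g u : u \in compA g -> s u \in compB g.
Proof.
move=> /gspanA; move: u; apply: lspan_ind => [|k u v uE vE|_ [v [vs <- ->]]].
- by rewrite raddf0 rpred0.
- by rewrite linearP rpredD ?rpredZ.
by rewrite s_mono // -degB_map.
Qed.

Lemma split_delta_comp g a : a \in compB g -> delta a \in compB g.
Proof.
move=> /gspanB; move: a; apply: lspan_ind => [|k u v uE vE|_ [v [vs <- ->]]].
- by rewrite raddf0 rpred0.
- by rewrite linearP rpredD ?rpredZ.
rewrite delta_mono //; case: v vs => [|[i|] v] vs; rewrite ?rpred0 //.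
by rewrite degB_None.
Qed.
End MonomialSplitting.

(** Here [E] is an extension of [L] by one central vector [z = bE None], placed
below a basis of [L]. *)
Section Splitting.
Variables (K : fieldType) (G : groupType) (eps : G -> G -> K).
Variables L E : colorLieAlgebra eps.
Local Notation comp := (@color_comp K G eps L).
Local Notation compE := (@color_comp K G eps E).
Hypothesis charK0 : [pchar K] =i pred0.
Hypothesis G_abelian : forall g h : G, (g * h)%g = (h * g)%g.
Hypothesis eps_bichar : antisym_bicharacter eps.
Variables (I : choiceType) (le : rel I) (d : I -> G) (b : I -> L).
Hypothesis bP : homogeneous_basis le d b.
Variables (bE : option I -> E).
Variables (proj : {linear E -> L}) (lift : {linear L -> E}).
Local Notation dE := (cext_deg d).
Local Notation z := (bE None).
Hypothesis bEP : homogeneous_basis (cext_le le) dE bE.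
Hypothesis z_central : forall x, color_br x z = 0.
Hypothesis proj_z : proj z = 0.
Hypothesis proj_lift : cancel lift proj.
Hypothesis lift_b : forall i, lift (b i) = bE (Some i).
Hypothesis lift_comp : forall g x, x \in comp g -> lift x \in compE g.
Hypothesis proj_comp : forall g x, x \in compE g -> proj x \in comp g.
Hypothesis proj_br : forall x y,
  proj (color_br x y) = color_br (proj x) (proj y).

Local Notation standard := (is_standard le (odd_index eps d)).
Local Notation standardE := (is_standard (cext_le le) (odd_index eps dE)).
Local Notation mono := (monomial b).
Local Notation monoE := (monomial bE).
Local Notation t := (env_in z).

Lemma descentN_None j : ~~ is_descent (cext_le le) (odd_index eps dE) None j.
Proof.
rewrite /is_descent /= negb_and /odd_index /= (bichar1l eps_bichar).
by rewrite eqxx orbT.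
Qed.

Lemma standard_map_Some v : standardE (map Some v) = standard v.
Proof. by rewrite /is_standard sorted_map. Qed.

Lemma standard_None v : standardE v -> standardE (None :: v).
Proof. by case: v => //= j v; rewrite /is_standard /= descentN_None. Qed.

(** As [None] is the least letter, it can only occur at the front of a standard
word. *)
Lemma standardE_case v : standardE v ->
  (exists2 v', v = None :: v' & standardE v') \/
  (exists2 v', v = map Some v' & standard v').
Proof.
case: v => [|[i|] v] vs; first by right; exists [::].
  right; have [v' vE] : exists v', Some i :: v = map Some v'.
    elim: v i vs => [|[j|] v IHv] i /=; first by exists [:: i].
      by rewrite /is_standard /= => /andP[_ /IHv[v' ->]]; exists (i :: v').
    by rewrite /is_standard /=.
  by exists v'; rewrite // -standard_map_Some -vE.
by left; exists v => //; apply: path_sorted vs.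
Qed.

Lemma monoE_None v : monoE (None :: v) = t * monoE v.
Proof. by rewrite monomial_cons. Qed.

Lemma word_degreeE_map v : word_degree dE (map Some v) = word_degree d v.
Proof. by rewrite /word_degree big_map. Qed.

Lemma word_degreeE_None v : word_degree dE (None :: v) = word_degree dE v.
Proof. by rewrite word_degree_cons mul1g. Qed.

Lemma env_center_commutes a : a * t = t * a.
Proof.
move: a; apply: env_alg_ind => [|k u v uE vE|g x u xg uE].
- by rewrite mulr1 mul1r.
- by rewrite mulrDl mulrDr -scalerAl -scalerAr uE vE.
have := env_in_br xg (basis_comp bEP None).
rewrite z_central (bichar1r eps_bichar) scale1r raddf0.
move/eqP; rewrite subr_eq0 => /eqP xt.
by rewrite -mulrA uE mulrA xt mulrA.
Qed.

(** The section [s] maps a standard monomial to the same monomial in [E], and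
[delta] erases a leading [z]; both are well defined by [pbw_extend]. *)
Lemma central_extension_splitting :
  exists (pi : {lrmorphism env_alg E -> env_alg L})
    (s : {linear env_alg L -> env_alg E})
    (delta : {linear env_alg E -> env_alg E}),
  [/\ pi t = 0, forall a, delta (t * a) = a, forall u, pi (s u) = u &
      forall a, a = s (pi a) + t * delta a] /\
  [/\ forall g a, a \in env_comp E g -> pi a \in env_comp L g,
      forall g u, u \in env_comp L g -> s u \in env_comp E g,
      forall g a, a \in env_comp E g -> delta a \in env_comp E g &
      forall x, s (env_in x) = env_in (lift x)].
Proof.
pose pL : {linear E -> env_alg L} := @env_in K G eps L \o proj.
have [|pi piE] := env_alg_lift (f := pL).
  move=> g h x y xg yh; rewrite /pL /= proj_br.
  by rewrite (env_in_br (proj_comp xg) (proj_comp yh)).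
have [s sE] := pbw_extend charK0 eps_bichar bP G_abelian
  (fun v => monoE (map Some v)).
have [delta deltaE] := pbw_extend charK0 eps_bichar bEP G_abelian
  (fun v => if v is None :: v' then monoE v' else 0).
have pi_t : pi t = 0 by rewrite piE /pL /= proj_z raddf0.
have pi_mono v : pi (monoE (map Some v)) = mono v.
  rewrite /monomial rmorph_prod big_map; apply: eq_bigr => i _.
  by rewrite /= piE /pL /= -lift_b proj_lift.
have spanA := pbw_span charK0 eps_bichar bP G_abelian.
have spanB := pbw_span charK0 eps_bichar bEP G_abelian.
have gspanA := pbw_span_graded charK0 eps_bichar bP G_abelian.
have gspanB := pbw_span_graded charK0 eps_bichar bEP G_abelian.
exists pi, s, delta; split; split.
- exact: pi_t.
- exact: (split_delta_t standard_None spanB monoE_None deltaE).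
- exact: (split_pi_s spanA pi_mono sE).
- exact: (split_decomp standard_map_Some standard_None standardE_case spanB
    monoE_None pi_t pi_mono sE deltaE).
- exact: (split_pi_comp standardE_case word_degreeE_map gspanB
    (monomial_comp bP) monoE_None pi_t pi_mono).
- exact: (split_s_comp word_degreeE_map gspanA (monomial_comp bEP) sE).
- exact: (split_delta_comp word_degreeE_None gspanB (monomial_comp bEP) deltaE).
move=> x; move: x; apply: (basis_ind bP) => [|a x y xE yE|i].
- by rewrite !raddf0.
- by rewrite !linearP /= xE yE.
by have := sE [:: i] isT; rewrite /monomial !big_seq1 lift_b.
Qed.

(** The functional exhibiting [w] as a coboundary is [x |-> - aug (f x)], with
[f] the first-order term of the equivalence; it has degree 1 because [f] is
graded and the augmentation vanishes outside that degree. *)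
Lemma star_trivial_coboundary (w : L -> L -> K)
    (pi : {lrmorphism env_alg E -> env_alg L})
    (s : {linear env_alg L -> env_alg E})
    (delta : {linear env_alg E -> env_alg E}) :
  (forall a, delta (t * a) = a) -> (forall u, pi (s u) = u) ->
  (forall a, a = s (pi a) + t * delta a) ->
  (forall x, s (env_in x) = env_in (lift x)) ->
  is_cocycle2 w ->
  (forall x y, color_br (lift x) (lift y) = lift (color_br x y) + w x y *: z) ->
  graded_deformation (env_comp L) (star pi s delta) ->
  trivial_deformation (env_comp L) (star pi s delta) -> is_coboundary2 w.
Proof.
move=> delta_t pi_s decomp s_in wZ w_br star_def.
move=> /(trivial_deformation_order1 star_def)[f [f_lin f_comp] fE].
have [aug [aug_in aug_comp]] := augmentation_exists L.
pose F x : K := aug (f (env_in x)).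
have f0 : f 0 = 0 := linear_at0 f_lin.
have F_lin : scalar F by move=> a x y; rewrite /F linearP f_lin linearP.
have F0 : F 0 = 0 by rewrite /F raddf0 f0 raddf0.
have wF_hom g h x y : x \in comp g -> y \in comp h -> w x y = F (color_br x y).
  move=> xg yh.
  have sxy : s (env_in x) * s (env_in y)
      - eps g h *: (s (env_in y) * s (env_in x))
      = s (env_in (color_br x y)) + w x y *: t.
    rewrite !s_in (env_in_br (lift_comp xg) (lift_comp yh)) w_br.
    by rewrite raddfD /= linearZ.
  have := coboundary_commutator (eps g h) f_lin fE (aug_in x) (aug_in y).
  rewrite (star1_commutator delta_t pi_s decomp sxy) (env_in_br xg yh) /F => <-.
  by rewrite linearZ /= rmorph1 /GRing.scale /= mulr1.
have wF x y : w x y = F (color_br x y).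
  move: x; apply: (basis_ind bP) => [|a x x' xE x'E|i].
  - by rewrite color_br0l F0 (cocycle2_0l wZ).
  - by rewrite color_br_linearl F_lin (cocycle2_linearl wZ) xE x'E.
  move: y; apply: (basis_ind bP) => [|a y y' yE y'E|j].
  - by rewrite color_br0r F0 (cocycle2_0r wZ).
  - by rewrite color_br_linearr F_lin (cocycle2_linearr wZ) yE y'E.
  exact: wF_hom (basis_comp bP i) (basis_comp bP j).
exists (fun x => - F x); split=> [a x y|g x xg g1|].
- by rewrite F_lin opprD mulrN.
- by rewrite /F (aug_comp g) ?oppr0 //; apply: f_comp; apply: env_in_comp.
by apply/funext => x; apply/funext => y; rewrite opprK wF.
Qed.
End Splitting.

(** * Non-trivial graded deformations *)

Theorem theorem3 (K : fieldType) (charK0 : [pchar K] =i pred0)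
    (G : groupType) (G_abelian : forall g h : G, (g * h)%g = (h * g)%g)
    (eps : G -> G -> K) (eps_bichar : antisym_bicharacter eps)
    (L : colorLieAlgebra eps) :
  (exists c : H2 L, c != 0) ->
  exists m : nat -> env_alg L -> env_alg L -> env_alg L,
    graded_deformation (@env_comp K G eps L) m /\
    ~ trivial_deformation (@env_comp K G eps L) m.
Proof.
move=> /H2_neq0P[w wZ w_not_coboundary].
have [I [le [d [b bP]]]] := homogeneous_basis_exists L.
pose E := central_extension eps_bichar wZ.
have bEP := cext_basisP eps_bichar wZ bP; set bE := cext_basis _ _ b in bEP.
have proj_lin : linear (fun p : E => p.1 : L) by [].
pose proj : {linear E -> L} := HB.pack (fun p : E => p.1 : L)
  (GRing.isLinear.Build K E L *:%R _ proj_lin).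
have lift_lin : linear (fun x : L => (x, 0) : E).
  by move=> a x y; congr (_, _); rewrite /= scaler0 addr0.
pose lift : {linear L -> E} := HB.pack (fun x : L => (x, 0) : E)
  (GRing.isLinear.Build K L E *:%R _ lift_lin).
have z_central (x : E) : color_br x (bE None) = 0.
  by congr (_, _); rewrite /= ?color_br0r ?(cocycle2_0r wZ).
have br_lift x y : color_br (lift x) (lift y) =
    lift (color_br x y) + w x y *: bE None.
  by congr (_, _); rewrite /= ?scaler0 ?addr0 // add0r /GRing.scale /= mulr1.
have proj_z : proj (bE None) = 0 by [].
have proj_lift : cancel lift proj by [].
have lift_b i : lift (b i) = bE (Some i) by [].
have lift_comp g x : x \in color_comp L g -> lift x \in color_comp E g.
  exact: cext_comp_inl.
have proj_comp g x : x \in color_comp E g -> proj x \in color_comp L g.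
  by case/andP.
have proj_br x y : proj (color_br x y) = color_br (proj x) (proj y) by [].
have [pi [s [delta [[pi_t delta_t pi_s dec] [pi_c s_c delta_c s_in]]]]] :=
  central_extension_splitting charK0 G_abelian eps_bichar bP bEP
    proj_z proj_lift lift_b proj_comp proj_br.
exists (star pi s delta).
have star_def := star_graded_deformation pi_t
  (env_center_commutes eps_bichar bEP z_central) delta_t pi_s dec
  (@env_comp_mul _ _ _ E) pi_c s_c delta_c.
split; first exact: star_def.
move=> triv; apply: w_not_coboundary.
exact: (star_trivial_coboundary bP lift_comp delta_t pi_s dec s_in wZ br_lift
  star_def triv).
Qed.
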